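(* Let $f:\mathbb{R}^n\to\mathbb{R}$ be convex and $L$-smooth, with stochastic gradients satisfying $\mathbb{E}_\xi[\nabla f(x,\xi)]=\nabla f(x)$ and $\mathbb{E}_\xi[\|\nabla f(x,\xi)-\nabla f(x)\|_2^2]\le\sigma^2$ for all $x\in\mathbb{R}^n$. Let $x^*$ be a minimizer of $f$, $R_0=\|x^0-x^*\|_2>0$ and $C=\sqrt5$. Then for all $\beta\in(0,1)$ and $N\ge1$ such that $\ln\frac{4N}{\beta}\ge2$, after $N$ iterations of clipped-SSTM started at $x^0$ with $$m_k=\left\lceil\max\left\{1,\frac{6000\sigma^2\alpha_{k+1}^2N\ln\frac{4N}{\beta}}{C^2R_0^2},\frac{10368\sigma^2\alpha_{k+1}^2N}{C^2R_0^2}\right\}\right\rceil,\qquad B=\frac{CR_0}{8\ln\frac{4N}{\beta}},$$ $$a\ge\max\left\{1,\frac{16\ln\frac{4N}{\beta}}{C},36\left(2\ln\frac{4N}{\beta}+\sqrt{4\ln^2\frac{4N}{\beta}+2\ln\frac{4N}{\beta}}\right)^2\right\},\qquad(\star)$$ we have, with probability at least $1-\beta$, $$f(y^N)-f(x^* )\le\frac{2aLC^2R_0^2}{N(N+3)}.$$ In other words, if $a$ is chosen equal to the maximum in $(\star)$, then there is an absolute constant $K$ such that with $N=\left\lceil K\sqrt{\frac{LR_0^2}{\varepsilon}}\ln\frac{LR_0^2}{\varepsilon\beta}\right\rceil$ iterations the method achieves $f(y^N)-f(x^* )\le\varepsilon$ with probability at least $1-\beta$, and the total number of oracle calls is $$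\sum_{k=0}^{N-1}m_k=O\left(\max\left\{\sqrt{\frac{LR_0^2}{\varepsilon}},\frac{\sigma^2R_0^2}{\varepsilon^2}\right\}\ln\frac{LR_0^2}{\varepsilon\beta}\right).$$
   Context: Problem: minimize $f(x)=\mathbb{E}_\xi[f(x,\xi)]$ over $x\in\mathbb{R}^n$; a minimizer $x^*$ is assumed to exist. $f$ is accessed only through stochastic gradients $\nabla f(x,\xi)$; $\sigma\ge0$; nothing is assumed about their distribution beyond unbiasedness and variance at most $\sigma^2$. One oracle call is one sample of $\nabla f(x,\xi)$. $f$ is $L$-smooth ($L>0$) if it is differentiable and $\|\nabla f(x)-\nabla f(y)\|_2\le L\|x-y\|_2$ for all $x,y\in\mathbb{R}^n$. Clipping: $\mathrm{clip}(g,\lambda)=\min\{1,\lambda/\|g\|_2\}\,g$ (and $\mathrm{clip}(0,\lambda)=0$). Algorithm clipped-SSTM. Inputs: deterministic starting point $x^0$, number of iterations $N$, batchsizes $m_0,\dots,m_{N-1}$ (positive integers), stepsize parameter $a>0$, clipping parameter $B>0$. Set $A_0=\alpha_0=0$, $y^0=z^0=x^0$. For $k=0,\dots,N-1$: set $\alpha_{k+1}=\frac{k+2}{2aL}$, $A_{k+1}=A_k+\alpha_{k+1}$, $\lambda_{k+1}=\frac{B}{\alpha_{k+1}}$; $x^{k+1}=(A_ky^k+\alpha_{k+1}z^k)/A_{k+1}$; draw fresh i.i.d. samples $\xi^k_1,\dots,\xi^k_{m_k}$ (independent of the past) and compute $\nabla f(x^{k+1},\boldsymbol{\xi}^k)=\frac1{m_k}\sum_{i=1}^{m_k}\nabla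 f(x^{k+1},\xi_i^k)$; compute $\widetilde\nabla f(x^{k+1},\boldsymbol{\xi}^k)=\mathrm{clip}(\nabla f(x^{k+1},\boldsymbol{\xi}^k),\lambda_{k+1})$; $z^{k+1}=z^k-\alpha_{k+1}\widetilde\nabla f(x^{k+1},\boldsymbol{\xi}^k)$; $y^{k+1}=(A_ky^k+\alpha_{k+1}z^{k+1})/A_{k+1}$. Output: $y^N$. $O(\cdot)$ hides absolute numerical constants; complexity bounds are for target accuracies $0<\varepsilon\le LR_0^2/2$. *)

(* Defs.v *)
From HB Require Import structures.
From mathcomp Require Import all_boot all_order all_algebra.
From mathcomp Require Import all_classical all_reals all_analysis.

Set Implicit Arguments.
Unset Strict Implicit.
Unset Printing Implicit Defensive.

Import Order.TTheory GRing.Theory Num.Theory.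
Import numFieldNormedType.Exports.

Local Open Scope classical_set_scope.
Local Open Scope ring_scope.

(* The library's norm on 'rV[R]_n is the sup norm, hence a separate Euclidean
   norm. The two induce the same topology, so the library's differentiability
   is the usual one. *)
Definition l2norm (R : realType) (n : nat) (v : 'rV[R]_n) : R :=
  Num.sqrt (\sum_(i < n) v 0 i ^+ 2).

Definition gradient (R : realType) (n : nat) (f : 'rV[R]_n -> R)
    (x : 'rV[R]_n) : 'rV[R]_n :=
  \row_(i < n) 'D_(delta_mx 0 i) f x.

Definition l_smooth (R : realType) (n : nat) (L : R) (f : 'rV[R]_n -> R) : Prop :=
  (forall x, differentiable f x) /\
  (forall x y, l2norm (gradient f x - gradient f y) <= L * l2norm (x - y)).

Definition minimizer (R : realType) (n : nat) (f : 'rV[R]_n -> R)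
    (xs : 'rV[R]_n) : Prop := forall x, f xs <= f x.

(* Joint measurability of a stochastic gradient in the point and the sample,
   which makes the iterates of the method random variables. The points are
   encoded as tuples because the library's product sigma-algebra on
   [n.-tuple R] is the Borel sigma-algebra of R^n. *)
Definition oracle_measurable (R : realType) (n : nat) (dX : measure_display)
    (Xi : measurableType dX) (G : 'rV[R]_n -> Xi -> 'rV[R]_n) : Prop :=
  forall j : 'I_n, measurable_fun [set: n.-tuple R * Xi]
    (fun p => G (\row_(i < n) tnth p.1 i) p.2 0 j).

(* The integral of a measurable function with values in R is finite only if
   both its positive and negative parts have finite integrals, so this equation
   includes the integrability of the stochastic gradient. *)
Definition unbiased (R : realType) (n : nat) (dX : measure_display)
    (Xi : measurableType dX) (D : probability Xi R)
    (f : 'rV[R]_n -> R) (G : 'rV[R]_n -> Xi -> 'rV[R]_n) : Prop :=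
  forall (x : 'rV[R]_n) (j : 'I_n),
    ('E_D[fun xi => G x xi 0%R j] = (gradient f x 0%R j)%:E)%E.

Definition variance_bounded (R : realType) (n : nat) (dX : measure_display)
    (Xi : measurableType dX) (D : probability Xi R)
    (f : 'rV[R]_n -> R) (G : 'rV[R]_n -> Xi -> 'rV[R]_n) (sigma : R) : Prop :=
  forall x : 'rV[R]_n,
    ('E_D[fun xi => (l2norm (G x xi - gradient f x) ^+ 2)%R]
       <= (sigma ^+ 2)%:E)%E.

Record smooth_convex_problem (R : realType) (n : nat) (dX : measure_display)
    (Xi : measurableType dX) (D : probability Xi R) (f : 'rV[R]_n -> R)
    (G : 'rV[R]_n -> Xi -> 'rV[R]_n) (L sigma : R) (xs : 'rV[R]_n) : Prop := {
  L_gt0 : 0 < L ;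
  sigma_ge0 : 0 <= sigma ;
  f_convex : convex_function [set: 'rV[R]_n] f ;
  f_smooth : l_smooth L f ;
  f_minimizer : minimizer f xs ;
  G_measurable : oracle_measurable G ;
  G_unbiased : unbiased D f G ;
  G_variance : variance_bounded D f G sigma
}.

Definition mutually_independent (R : realType) (d dX : measure_display)
    (T : measurableType d) (Xi : measurableType dX) (P : probability T R)
    (I : eqType) (A : set I) (X : I -> {RV P >-> Xi}) : Prop :=
  forall (s : seq I) (E : I -> set Xi), uniq s ->
    (forall i, i \in s -> A i) -> (forall i, i \in s -> measurable (E i)) ->
    (P (\bigcap_(i in [set` s]) (X i @^-1` E i)) =
       \prod_(i <- s) P (X i @^-1` E i))%E.

(* [xi k i] is the i-th sample of iteration k; only the samples that the method
   uses in N iterations are constrained. As the starting point is deterministic,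
   the past of iteration k is determined by the samples of earlier iterations,
   so mutual independence makes every batch independent of the past. *)
Definition iid_samples (R : realType) (d dX : measure_display)
    (T : measurableType d) (Xi : measurableType dX) (P : probability T R)
    (D : probability Xi R) (N : nat) (m : nat -> nat)
    (xi : nat -> nat -> {RV P >-> Xi}) : Prop :=
  (forall k i, (k < N)%N -> (i < m k)%N ->
     forall E, measurable E -> distribution P (xi k i) E = D E) /\
  mutually_independent [set ki | (ki.1 < N)%N /\ (ki.2 < m ki.1)%N]
    (fun ki : nat * nat => xi ki.1 ki.2).

(* For g = 0 this gives 0, whatever the value of the division by zero. *)
Definition clip (R : realType) (n : nat) (g : 'rV[R]_n) (lambda : R) : 'rV[R]_n :=
  Num.min 1 (lambda / l2norm g) *: g.

Definition sstm_alpha (R : realType) (a L : R) (k : nat) : R :=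
  if k is j.+1 then j.+2%:R / (2 * a * L) else 0.

Fixpoint sstm_A (R : realType) (a L : R) (k : nat) : R :=
  if k is j.+1 then sstm_A a L j + sstm_alpha a L j.+1 else 0.

Definition batch_gradient (R : realType) (n : nat) (Xi : Type)
    (G : 'rV[R]_n -> Xi -> 'rV[R]_n) (m : nat) (s : nat -> Xi)
    (x : 'rV[R]_n) : 'rV[R]_n :=
  m%:R^-1 *: \sum_(i < m) G x (s i).

(* The pair (y^k, z^k) along a realization s of the samples. *)
Fixpoint clipped_sstm (R : realType) (n : nat) (Xi : Type)
    (G : 'rV[R]_n -> Xi -> 'rV[R]_n) (L a B : R) (m : nat -> nat)
    (x0 : 'rV[R]_n) (s : nat -> nat -> Xi) (k : nat) : 'rV[R]_n * 'rV[R]_n :=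
  if k is j.+1 then
    let: (y, z) := clipped_sstm G L a B m x0 s j in
    let alpha := sstm_alpha a L j.+1 in
    let lambda := B / alpha in
    let x := (sstm_A a L j.+1)^-1 *: (sstm_A a L j *: y + alpha *: z) in
    let g := clip (batch_gradient G (m j) (s j) x) lambda in
    let z' := z - alpha *: g in
    let y' := (sstm_A a L j.+1)^-1 *: (sstm_A a L j *: y + alpha *: z') in
    (y', z')
  else (x0, x0).

Definition clipped_sstm_output (R : realType) (n : nat) (Xi : Type)
    (G : 'rV[R]_n -> Xi -> 'rV[R]_n) (L a B : R) (m : nat -> nat)
    (x0 : 'rV[R]_n) (s : nat -> nat -> Xi) (N : nat) : 'rV[R]_n :=
  (clipped_sstm G L a B m x0 s N).1.

Definition ceiln (R : realType) (x : R) : nat := `|Num.ceil (Num.max 0%R x)|%N.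

Definition ln4Nbeta (R : realType) (N : nat) (beta : R) : R :=
  ln (4 * N%:R / beta).

Definition sstm_batchsize (R : realType) (C R0 sigma L a beta : R) (N : nat)
    (k : nat) : nat :=
  let alpha := sstm_alpha a L k.+1 in
  ceiln (Num.max 1 (Num.max
    (6000 * sigma ^+ 2 * alpha ^+ 2 * N%:R * ln4Nbeta N beta / (C ^+ 2 * R0 ^+ 2))
    (10368 * sigma ^+ 2 * alpha ^+ 2 * N%:R / (C ^+ 2 * R0 ^+ 2)))).

Definition sstm_clipping (R : realType) (C R0 beta : R) (N : nat) : R :=
  C * R0 / (8 * ln4Nbeta N beta).

Definition sstm_stepsize (R : realType) (C beta : R) (N : nat) : R :=
  let l := ln4Nbeta N beta in
  Num.max 1 (Num.max (16 * l / C)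
    (36 * (2 * l + Num.sqrt (4 * l ^+ 2 + 2 * l)) ^+ 2)).

(* Main.v *)
(** Along the method, the potential
      Phi_k = A_k (f y^k - f xs) + |z^k - xs|^2 / 2
    grows in one step by at most al <theta, xs - z^k> + (51/100) al^2 |theta|^2,
    where theta is the error of the clipped gradient at x^(k+1).  As long as
    Phi_k <= r^2 / 2 with r = sqrt 5 * R0 and y^k is within r of xs, the true
    gradient at x^(k+1) has norm at most half the clipping level.  Clipping is a
    projection on a ball that then contains the true gradient, so theta is no
    larger than the unclipped error delta, its bias is quadratic in delta, and
    exp (s (Phi_(k+1) - Phi_k)), s = l / R0^2, l = ln (4 N / beta), is bounded by
    1 + <c, delta> + q |delta|^2, whose mean is at most exp (l / N) for the
    prescribed batch size.  Stopping the potential when it leaves the good region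
    gives an exponential supermartingale, and Markov's inequality bounds the
    failure probability by exp (- l) = beta / (4 N).
    Conditional expectations are avoided: the state of the method is independent
    of each fresh sample, so one sample is integrated out at a time by Tonelli. *)

Require Import Defs.
From HB Require Import structures.
From mathcomp Require Import all_boot all_order all_algebra.
From mathcomp Require Import all_classical all_reals all_analysis.
From mathcomp Require Import measurable_realfun.
From mathcomp Require Import ring lra.

Set Implicit Arguments.
Unset Strict Implicit.
Unset Printing Implicit Defensive.

Import Order.TTheory GRing.Theory Num.Theory.
Import numFieldNormedType.Exports.

Local Open Scope classical_set_scope.
Local Open Scope ring_scope.

(** * Euclidean inner product and clipping *)

(** The noise has only a second moment, so its exponential need not be integrable. Clipping repairs
    this: with B = r / (8 l) the exponent s (Phi_(k+1) - Phi_k) is at most 1 in the good region,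
    whatever the samples. On that range exp u <= 1 + u + 2 u^2, and the bound becomes a polynomial
    of degree two in the unclipped noise. Such polynomials keep their form when one sample of a
    batch is averaged out, which is why mean and variance suffice.

    The argument looks circular: gradients are small because the iterates stayed near xs, and the
    iterates stay near xs because clipping small gradients does little harm. The stopped sum breaks
    the circle. The mean growth of its exponential is controlled from every state, and a trajectory
    whose sum ends below r^2 / 2 was never stopped, by a pathwise induction.

    C = sqrt 5 balances the exponents: s r^2 / 2 = 5 l / 2 at exit, l / 2 at the start, and l / N
    for each of N steps leave exactly l. *)

Definition inner (R : realType) (n : nat) (u v : 'rV[R]_n) : R :=
  \sum_(i < n) u 0 i * v 0 i.

Section inner.
Context {R : realType} {n : nat}.
Implicit Types (u v w p g : 'rV[R]_n) (c lambda : R).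

Lemma innerC u v : inner u v = inner v u.
Proof. by apply: eq_bigr => i _; rewrite mulrC. Qed.

Lemma innerDl u v w : inner (u + v) w = inner u w + inner v w.
Proof. by rewrite /inner -big_split; apply: eq_bigr => i _; rewrite mxE mulrDl. Qed.

Lemma innerZl c u v : inner (c *: u) v = c * inner u v.
Proof. by rewrite /inner mulr_sumr; apply: eq_bigr => i _; rewrite mxE mulrA. Qed.

Lemma innerNl u v : inner (- u) v = - inner u v.
Proof. by rewrite -scaleN1r innerZl mulN1r. Qed.

Lemma innerDr u v w : inner w (u + v) = inner w u + inner w v.
Proof. by rewrite innerC innerDl !(innerC w). Qed.

Lemma innerZr c u v : inner u (c *: v) = c * inner u v.
Proof. by rewrite innerC innerZl innerC. Qed.

Lemma innerNr u v : inner u (- v) = - inner u v.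
Proof. by rewrite innerC innerNl innerC. Qed.

Definition innerE := (innerDl, innerDr, innerNl, innerNr, innerZl, innerZr).

Lemma inner_ge0 u : 0 <= inner u u.
Proof. by apply: sumr_ge0 => i _; rewrite -expr2 sqr_ge0. Qed.

Lemma l2norm_ge0 u : 0 <= l2norm u.
Proof. exact: sqrtr_ge0. Qed.

Lemma sqr_l2norm u : l2norm u ^+ 2 = inner u u.
Proof.
rewrite /l2norm sqr_sqrtr; last by apply: sumr_ge0 => i _; rewrite sqr_ge0.
by apply: eq_bigr => i _; rewrite expr2.
Qed.

Lemma l2norm_le u c : 0 <= c -> (l2norm u <= c) = (inner u u <= c ^+ 2).
Proof. by move=> c0; rewrite -sqr_l2norm ler_sqr// nnegrE l2norm_ge0. Qed.

Lemma l2normZ c u : l2norm (c *: u) = `|c| * l2norm u.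
Proof.
apply/eqP; rewrite -(@eqrXn2 _ 2)// ?mulr_ge0 ?l2norm_ge0//.
by rewrite exprMn !sqr_l2norm !innerE real_normK ?num_real// mulrA -expr2.
Qed.

Lemma l2normN u : l2norm (- u) = l2norm u.
Proof. by rewrite -scaleN1r l2normZ normrN1 mul1r. Qed.

Lemma l2normBC u v : l2norm (u - v) = l2norm (v - u).
Proof. by rewrite -l2normN opprB. Qed.

Lemma l2norm0_eq0 u : l2norm u = 0 -> u = 0.
Proof.
move=> u0; have := sqr_l2norm u; rewrite u0 expr0n/= => /esym/eqP.
rewrite psumr_eq0; last by move=> i _; rewrite -expr2 sqr_ge0.
move=> /allP ui; apply/rowP => i; rewrite mxE; apply/eqP.
by have := ui i (mem_index_enum i); rewrite mulf_eq0 orbb.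
Qed.

(** Cauchy-Schwarz, by expanding the square of |v| u - |u| v. Vanishing norms are treated apart
    because the outcome is divided by |u| |v|. *)
Lemma inner_le u v : inner u v <= l2norm u * l2norm v.
Proof.
have [u0|u0] := eqVneq (l2norm u) 0.
  rewrite u0 mul0r (l2norm0_eq0 u0) /inner big1// => i _.
  by rewrite mxE mul0r.
have [v0|v0] := eqVneq (l2norm v) 0.
  rewrite v0 mulr0 (l2norm0_eq0 v0) /inner big1// => i _.
  by rewrite mxE mulr0.
have uv0 : 0 < l2norm u * l2norm v.
  by rewrite mulr_gt0// lt_def ?u0 ?v0 l2norm_ge0.
have := inner_ge0 (l2norm v *: u - l2norm u *: v).
rewrite !innerE -!sqr_l2norm (innerC v u) => h.
by rewrite -(ler_pM2l uv0); nra.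
Qed.

Lemma inner_ge u v : - (l2norm u * l2norm v) <= inner u v.
Proof. by rewrite lerNl -innerNl (le_trans (inner_le _ _))// l2normN. Qed.

Lemma l2normD u v : l2norm (u + v) <= l2norm u + l2norm v.
Proof.
rewrite l2norm_le ?addr_ge0 ?l2norm_ge0// !innerE -!sqr_l2norm (innerC v u).
have := inner_le u v; nra.
Qed.

Lemma l2normB u v : l2norm (u - v) <= l2norm u + l2norm v.
Proof. by rewrite -(l2normN v) l2normD. Qed.

Lemma coord_le_l2norm u i : `|u 0 i| <= l2norm u.
Proof.
rewrite -(@ler_pXn2r _ 2)// ?nnegrE ?l2norm_ge0// sqr_l2norm.
rewrite real_normK ?num_real// /inner (bigD1 i)//= expr2 lerDl.
by apply: sumr_ge0 => j _; rewrite -expr2 sqr_ge0.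
Qed.

Lemma clip_small g lambda : 0 < lambda -> l2norm g <= lambda ->
  clip g lambda = g.
Proof.
move=> l0 gl; rewrite /clip; have [g0|g0] := eqVneq (l2norm g) 0.
  by rewrite (l2norm0_eq0 g0) scaler0.
have gp : 0 < l2norm g by rewrite lt_def g0 l2norm_ge0.
by rewrite (min_idPl _) ?scale1r// ler_pdivlMr// mul1r.
Qed.

Lemma clip_large g lambda : 0 < lambda -> lambda < l2norm g ->
  clip g lambda = (lambda / l2norm g) *: g.
Proof.
move=> l0 gl; have gp := lt_trans l0 gl.
by rewrite /clip (min_idPr _)// ler_pdivrMr// mul1r ltW.
Qed.

Lemma l2norm_clip g lambda : 0 < lambda -> l2norm (clip g lambda) <= lambda.
Proof.
move=> l0; have [gl|gl] := leP (l2norm g) lambda; first by rewrite clip_small.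
have gp := lt_trans l0 gl.
rewrite clip_large// l2normZ ger0_norm; last by rewrite divr_ge0// ltW.
by rewrite divfK ?gt_eqF.
Qed.

(** As p lies in the ball of radius lambda, <g, p> <= lambda |g| = t |g|^2. The gain |g - p|^2 - |t
    g - p|^2 factors as (1 - t) (2 (t |g|^2 - <g, p>) + (1 - t) |g|^2), with both factors
    nonnegative. *)
Lemma clip_nonexpansive g p lambda : 0 < lambda -> l2norm p <= lambda ->
  l2norm (clip g lambda - p) <= l2norm (g - p).
Proof.
move=> l0 pl; have [gl|gl] := leP (l2norm g) lambda; first by rewrite clip_small.
have gp := lt_trans l0 gl.
rewrite clip_large// l2norm_le ?l2norm_ge0// sqr_l2norm.
set t := lambda / l2norm g.
have t0 : 0 < t by rewrite divr_gt0.
have t1 : t < 1 by rewrite ltr_pdivrMr ?mul1r.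
have gtl : t * l2norm g = lambda by rewrite divfK ?gt_eqF.
have gpl : inner g p <= l2norm g * lambda.
  by rewrite (le_trans (inner_le _ _))// ler_pM2l.
have : inner g p <= t * inner g g.
  by rewrite (le_trans gpl)// -sqr_l2norm expr2 mulrA gtl mulrC.
rewrite !innerE (innerC p g) => h.
have : 0 <= (1 - t) * ((t * inner g g - inner g p) *+ 2 + (1 - t) * inner g g).
  apply: mulr_ge0; first by rewrite subr_ge0 ltW.
  by rewrite addr_ge0 ?mulrn_wge0 ?mulr_ge0 ?inner_ge0 ?subr_ge0// ltW.
lra.
Qed.

(** When clipping acts, the bias is |g| - lambda <= |g - p| - lambda / 2, and x - lambda / 2 <= x^2
    / (2 lambda) is (x - lambda)^2 >= 0. *)
Lemma clip_bias g p lambda : 0 < lambda -> l2norm p <= lambda / 2 ->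
  l2norm (clip g lambda - g) <= l2norm (g - p) ^+ 2 / (2 * lambda).
Proof.
move=> l0 pl; have [gl|gl] := leP (l2norm g) lambda.
  rewrite clip_small// subrr -(scale0r g) l2normZ normr0 mul0r.
  by rewrite divr_ge0 ?sqr_ge0// mulr_ge0// ltW.
have gp := lt_trans l0 gl.
have -> : clip g lambda - g = (lambda / l2norm g - 1) *: g.
  by rewrite clip_large// scalerBl scale1r.
rewrite l2normZ ler0_norm; last by rewrite subr_le0 ler_pdivrMr// mul1r ltW.
rewrite opprB mulrBl mul1r divfK ?gt_eqF//.
have := l2normD (g - p) p; rewrite subrK => h.
rewrite ler_pdivlMr; last by rewrite mulr_gt0.
have := sqr_ge0 (l2norm (g - p) - lambda); nra.
Qed.

End inner.

(** From 1 + x <= exp x at x = - u / 2, exp u <= (1 - u / 2)^-2. The polynomial dominates this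
    because (1 + u + 2 u^2) (1 - u / 2)^2 - 1 = u^2 (1 - u) (5 / 4 - u / 2). *)
Lemma expR_le_quadratic (R : realType) (u : R) : u <= 1 ->
  expR u <= 1 + u + 2 * u ^+ 2.
Proof.
move=> u1; have h0 : 0 < 1 - u / 2 by lra.
have hu : expR (u / 2) <= (1 - u / 2)^-1.
  have -> : expR (u / 2) = (expR (- (u / 2)))^-1 by rewrite expRN invrK.
  rewrite lef_pV2 ?posrE ?expR_gt0//.
  exact: (expR_ge1Dx (- (u / 2))).
have -> : expR u = expR (u / 2) ^+ 2 by rewrite expr2 -expRD -splitr.
apply: (@le_trans _ _ ((1 - u / 2)^-1 ^+ 2)).
  by rewrite ler_sqr// nnegrE ?expR_ge0// invr_ge0 ltW.
rewrite exprVn -div1r ler_pdivrMr ?exprn_gt0//.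
have : 0 <= u ^+ 2 * ((1 - u) * (5 / 4 - u / 2)).
  by rewrite mulr_ge0 ?sqr_ge0// mulr_ge0//; lra.
lra.
Qed.

(** * Smooth convex functions *)

Section smooth_convex.
Context {R : realType} {n : nat}.
Implicit Types (f : 'rV[R]_n -> R) (x y h : 'rV[R]_n) (L : R).

Lemma derive_gradient f x h : differentiable f x ->
  'D_h f x = inner (gradient f x) h.
Proof.
move=> df; rewrite deriveE// [in LHS](row_sum_delta h) linear_sum.
by apply: eq_bigr => i _; rewrite linearZ mxE deriveE// mulrC.
Qed.

Lemma is_derive_line f x h (t : R) : differentiable f (x + t *: h) ->
  is_derive t (1 : R) (fun s : R => f (x + s *: h)) (inner (gradient f (x + t *: h)) h).
Proof.
move=> df; set phi := fun s => _.
have E : (fun s : R => s^-1 *: ((phi \o shift t) (s *: (1 : R)) - phi t)) =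
         (fun s : R => s^-1 *: ((f \o shift (x + t *: h)) (s *: h) - f (x + t *: h))).
  apply/funext => s /=; congr (_ *: (f _ - _)).
  by rewrite [s *: 1]mulr1 scalerDl addrCA.
apply: DeriveDef; last by rewrite -derive_gradient// /derive E.
by rewrite /derivable E; exact: diff_derivable.
Qed.

Lemma MVT_line f x h (t : R) : (forall y, differentiable f y) -> 0 < t ->
  exists2 c, 0 < c < t &
    f (x + t *: h) - f x = t * inner (gradient f (x + c *: h)) h.
Proof.
move=> df t0.
have dphi s : is_derive s (1 : R) (fun s : R => f (x + s *: h))
    (inner (gradient f (x + s *: h)) h) by exact: is_derive_line.
have [|c] := MVT t0 (fun s _ => dphi s).
  apply: derivable_within_continuous => s _.
  by have [] := dphi s.
by rewrite in_itv scale0r addr0 subr0 mulrC => c0 ->; exists c.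
Qed.

Lemma gradient_line_le f L x h (c : R) : l_smooth L f -> 0 <= c ->
  `|inner (gradient f (x + c *: h)) h - inner (gradient f x) h|
    <= L * c * inner h h.
Proof.
move=> [_ lip] c0; have := lip (x + c *: h) x.
have -> : x + c *: h - x = c *: h by rewrite addrC addKr.
rewrite l2normZ ger0_norm// => le.
rewrite -innerNl -innerDl -sqr_l2norm ler_norml.
have := inner_le (gradient f (x + c *: h) - gradient f x) h.
have := inner_ge (gradient f (x + c *: h) - gradient f x) h.
move: le (l2norm_ge0 h); set G := l2norm _; set H := l2norm _ => le h0 g1 g2.
have : G * H <= L * c * H ^+ 2 by rewrite (le_trans (ler_wpM2r h0 le))// expr2 !mulrA.
by move=> gh; apply/andP; split; lra.
Qed.

(* The mean value theorem is applied to f minus the quadratic upper bound,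
   which keeps the constant L/2 without integrating the gradient. *)
Lemma smooth_upper_bound f L x h : l_smooth L f ->
  f (x + h) <= f x + inner (gradient f x) h + L / 2 * inner h h.
Proof.
move=> sf; have df := sf.1.
set g := inner (gradient f x) h; set H := inner h h.
pose psi := (fun s : R => f (x + s *: h)) -
  (g *: (id : R -> R) + (L / 2 * H) *: ((id : R -> R) ^+ 2)).
have dpsi s : is_derive s (1 : R) psi
    (inner (gradient f (x + s *: h)) h - (g + L * s * H)).
  have d1 : is_derive s (1 : R) (fun s : R => f (x + s *: h))
    (inner (gradient f (x + s *: h)) h) by exact: is_derive_line.
  have d2 : is_derive s (1 : R) (g *: (id : R -> R)) g.
    by apply: is_derive_eq; exact: mulr1.
  have d3 : is_derive s (1 : R) ((id : R -> R) ^+ 2) (2 * s).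
    by apply: is_derive_eq; rewrite [LHS]mulr1 expr1.
  have d4 : is_derive s (1 : R) ((L / 2 * H) *: ((id : R -> R) ^+ 2)) (L * s * H).
    by apply: is_derive_eq; rewrite -[LHS]/(_ * _); field.
  exact: (is_deriveB d1 (is_deriveD d2 d4)).
have [|c] := MVT (@ltr01 R) (fun s _ => dpsi s).
  apply: derivable_within_continuous => s _.
  by have [] := dpsi s.
rewrite in_itv/= => /andP[c0 c1]; rewrite subr0 mulr1.
have -> : psi 1 - psi 0 = f (x + h) - f x - g - L / 2 * H.
  by rewrite /psi !fctE scale1r scale0r addr0 /GRing.scale/=; ring.
have := gradient_line_le x h sf (ltW c0).
rewrite ler_norml -/g -/H => /andP[_ h1 h2].
lra.
Qed.

(** Convexity bounds f (x + t h) by the chord, the mean value theorem turns the difference quotient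
    into a slope at x + c h with c < t, and the Lipschitz gradient moves that slope to x at a cost
    below L t |h|^2, made at most e by the choice of t. *)
Lemma convex_lower_bound f L x y : l_smooth L f ->
  convex_function [set: 'rV[R]_n] f ->
  f x + inner (gradient f x) (y - x) <= f y.
Proof.
move=> sf cf; have df := sf.1; set h := y - x.
(* The step t chosen below divides by L |h|^2. If this is 0, the slope is constant along h and the
   mean value theorem suffices. *)
have [H0|H0] := eqVneq (L * inner h h) 0.
  have [c /andP[c0 c1] E] := MVT_line x h df (@ltr01 R).
  have := gradient_line_le x h sf (ltW c0).
  have -> : L * c * inner h h = c * (L * inner h h) by ring.
  rewrite H0 mulr0 normr_le0 subr_eq0 => /eqP g.
  by move: E; rewrite scale1r g mul1r /h [_ + (y - x)]addrC subrK => E; lra.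
have {}H0 : 0 < L * inner h h.
  rewrite lt_def H0/=; have := gradient_line_le x h sf ler01.
  by rewrite mulr1; apply: le_trans; exact: normr_ge0.
apply/ler_addgt0Pr => e e0.
pose t := Num.min 1 (e / (L * inner h h)).
have t0 : 0 < t by rewrite lt_min ltr01 divr_gt0.
have t1 : t <= 1 by rewrite ge_min lexx.
have te : t * (L * inner h h) <= e by rewrite -ler_pdivlMr// ge_min lexx orbT.
have [c /andP[c0 ct] E] := MVT_line x h df t0.
have := gradient_line_le x h sf (ltW c0).
rewrite ler_norml => /andP[g1 _].
have t01 : (0 <= t <= 1)%R by rewrite ltW.
have := cf (Itv01 (ltW t0) t1) y x (in_setT _) (in_setT _).
rewrite convRE/=.
have -> : conv (Itv01 (ltW t0) t1) (y : convex_lmodType _) x = x + t *: h :> 'rV[R]_n.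
  rewrite /conv/= /unstable.onem scalerBl scale1r /h scalerBr.
  by rewrite addrC addrAC -addrA.
rewrite /unstable.onem => cv.
have h2 : t * inner (gradient f (x + c *: h)) h <= t * (f y - f x) by lra.
rewrite ler_pM2l// in h2.
have : L * c * inner h h <= e.
  rewrite (le_trans _ te)// (mulrC L) -mulrA ler_pM2r// ltW//.
lra.
Qed.

(** The step - L^-1 grad f x lowers f by at least |grad f x|^2 / (2 L), and no point lies below f
    xs. *)
Lemma sqr_gradient_le f L x xs : 0 < L -> l_smooth L f -> minimizer f xs ->
  inner (gradient f x) (gradient f x) <= 2 * L * (f x - f xs).
Proof.
move=> L0 sf mf; have := smooth_upper_bound x (- L^-1 *: gradient f x) sf.
move: (mf (x + - L^-1 *: gradient f x)); rewrite !innerE; set G := inner _ _.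
set F := f (_ + _) => h1 h2.
have : G / (2 * L) <= f x - f xs.
  have -> : G / (2 * L) = L^-1 * G - L / 2 * (- L^-1 * (- L^-1 * G)).
    by field; rewrite gt_eqF.
  lra.
by rewrite ler_pdivrMr ?mulr_gt0// => h; rewrite mulrC.
Qed.

Lemma gradient_minimizer f L xs : 0 < L -> l_smooth L f -> minimizer f xs ->
  gradient f xs = 0.
Proof.
move=> L0 sf mf; apply: l2norm0_eq0.
have := sqr_gradient_le xs L0 sf mf; rewrite subrr mulr0 -sqr_l2norm => h.
by apply/eqP; rewrite -(@sqrf_eq0 _ (l2norm _)) eq_le h sqr_ge0.
Qed.

(** Transfers the Euclidean Lipschitz bound on the gradient to the sup norm that defines the
    topology; a crude constant is enough. *)
Lemma l2norm_le_mx_norm x : l2norm x <= n%:R * `|x|.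
Proof.
rewrite l2norm_le ?mulr_ge0//.
apply: (@le_trans _ _ (\sum_(i < n) `|x| ^+ 2)).
  apply: ler_sum => i _; rewrite -expr2 -real_normK ?num_real//.
  rewrite ler_sqr ?nnegrE// [leRHS]/Num.Def.normr/= mx_normrE.
  by apply/bigmax_geP; right; exists (0, i).
rewrite sumr_const card_ord exprMn -[leLHS]mulr_natl.
rewrite ler_wpM2r ?sqr_ge0// -natrX ler_nat.
by case: (n) => // k; rewrite leq_pmulr.
Qed.

Lemma continuous_gradient f L (i : 'I_n) : 0 < L -> l_smooth L f ->
  continuous (fun x => gradient f x 0 i).
Proof.
move=> L0 [_ lip] x; apply/(@cvgrPdist_lt _ _ _ _ (nbhs_filter x)) => e e0.
rewrite nearE; apply/nbhs_ballP.
exists ((L * n.+1%:R)^-1 * e) => /=; first by rewrite mulr_gt0 ?invr_gt0 ?mulr_gt0.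
rewrite -ball_normE => y/= xy.
have := coord_le_l2norm (gradient f x - gradient f y) i.
rewrite !mxE => /le_lt_trans; apply.
apply: (le_lt_trans (lip x y)).
apply: (@le_lt_trans _ _ (L * (n.+1%:R * `|x - y|))).
  rewrite ler_pM2l// (le_trans (l2norm_le_mx_norm _))// ler_wpM2r//.
  by rewrite ler_nat.
by rewrite mulrA -ltr_pdivlMl ?mulr_gt0.
Qed.

Lemma continuous_smooth f L : l_smooth L f -> continuous f.
Proof. by move=> [df _] x; exact: differentiable_continuous. Qed.

End smooth_convex.

(** * One step of the method *)

Definition potential (R : realType) (n : nat) (f : 'rV[R]_n -> R)
    (xs : 'rV[R]_n) (A : R) (y z : 'rV[R]_n) : R :=
  A * (f y - f xs) + inner (z - xs) (z - xs) / 2.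

(** Both x^(k+1) and y^(k+1) have this form, with z^k and z^(k+1) respectively. *)
Definition wavg (R : realType) (n : nat) (A alpha : R) (y z : 'rV[R]_n) :
    'rV[R]_n :=
  (A + alpha)^-1 *: (A *: y + alpha *: z).

Section sstm_step.
Context {R : realType} {n : nat}.
Implicit Types (f : 'rV[R]_n -> R) (x y z xs g p d u : 'rV[R]_n).

Lemma wavgB (A alpha : R) y z p : A + alpha != 0 ->
  wavg A alpha y z - p = (A + alpha)^-1 *: (A *: (y - p) + alpha *: (z - p)).
Proof.
move=> A0.
have -> : A *: (y - p) + alpha *: (z - p) = A *: y + alpha *: z - (A + alpha) *: p.
  by rewrite !scalerBr scalerDl opprD addrACA.
by rewrite [in RHS]scalerBr scalerA mulVf// scale1r.
Qed.

Lemma l2norm_wavg (A alpha r : R) y z p : 0 <= A -> 0 < alpha ->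
  l2norm (y - p) <= r -> l2norm (z - p) <= r ->
  l2norm (wavg A alpha y z - p) <= r.
Proof.
move=> A0 a0 yr zr; have Aa : 0 < A + alpha by rewrite ltr_wpDl.
rewrite wavgB ?gt_eqF// l2normZ ger0_norm; last by rewrite invr_ge0 ltW.
rewrite ler_pdivrMl// (le_trans (l2normD _ _))// !l2normZ !ger0_norm//; last exact: ltW.
by rewrite mulrDl lerD// ler_wpM2l// ltW.
Qed.

(** Since y^(k+1) = x - (alpha^2 / A') g, smoothness at x controls the new value, and the condition
    L alpha^2 / A' <= 1 / 100 makes its quadratic term at most alpha^2 |g|^2 / 200. Convexity at x
    towards y and xs, with weights A and alpha, controls the old one. As x is the barycentre of y
    and z, the linear terms in p combine into <p, z - xs>. *)
Lemma potential_step f L xs (A alpha : R) y z g :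
  0 < L -> l_smooth L f -> convex_function [set: 'rV[R]_n] f ->
  let p := gradient f (wavg A alpha y z) in
  let z' := z - alpha *: g in
  0 <= A -> 0 < alpha -> 100 * (L * alpha ^+ 2) <= A + alpha ->
  potential f xs (A + alpha) (wavg A alpha y z') z' - potential f xs A y z <=
  alpha * inner (g - p) (xs - z) +
    51 / 100 * alpha ^+ 2 * inner (g - p) (g - p).
Proof.
move=> L0 sf cf p z' A0 a0 La; set x := wavg A alpha y z in p *.
set A' := A + alpha in La *.
have A'0 : 0 < A' by rewrite /A' ltr_wpDl.
have xyz : A *: (y - x) + alpha *: (z - x) = 0.
  have := wavgB y z x (lt0r_neq0 A'0); rewrite subrr -/A' => /esym/eqP.
  by rewrite scaler_eq0 invr_eq0 (gt_eqF A'0)/= => /eqP.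
have pxyz : A * inner p (y - x) + alpha * inner p (z - x) = 0.
  by rewrite -!innerZr -innerDr xyz -(scale0r p) innerZr mul0r.
have y'E : wavg A alpha y z' = x + (- (alpha ^+ 2 / A')) *: g.
  rewrite /x /wavg -/A' /z' scalerBr addrA [in LHS]scalerBr scaleNr.
  by congr (_ - _); rewrite !scalerA; congr (_ *: _); ring.
have up := smooth_upper_bound x (- (alpha ^+ 2 / A') *: g) sf.
have cvy := convex_lower_bound x y sf cf.
have cvxs := convex_lower_bound x xs sf cf.
have zE : inner (z' - xs) (z' - xs) = inner (z - xs) (z - xs)
    - 2 * (alpha * inner g (z - xs)) + alpha ^+ 2 * inner g g.
  rewrite /z' addrAC; move: (z - xs) => w.
  by rewrite !innerE (innerC w g); ring.
rewrite /potential y'E zE; move: up cvy cvxs; rewrite -/p !innerE.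
set F := f (x + _).
move: pxyz; rewrite !innerE (innerC g p).
move: (f x) (f y) (f xs) => fx fy fs.
set px := inner p x; set py := inner p y; set pz := inner p z; set ps := inner p xs.
set gg := inner g g; set pg := inner p g; set gs := inner g xs; set gz := inner g z.
set pp := inner p p.
move=> pxyz up cvy cvxs.
have {}up : A' * F <= A' * fx - alpha ^+ 2 * pg + alpha ^+ 2 / 200 * gg.
  have e : alpha ^+ 2 / 200 * gg - A' * (L / 2 * (- (alpha ^+ 2 / A') * (- (alpha ^+ 2 / A') * gg))) =
     (A' - 100 * (L * alpha ^+ 2)) * (alpha ^+ 2 * gg / (200 * A')).
    by field; rewrite gt_eqF.
  have : 0 <= (A' - 100 * (L * alpha ^+ 2)) * (alpha ^+ 2 * gg / (200 * A')).
    apply: mulr_ge0; first by rewrite subr_ge0.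
    apply: divr_ge0; first by rewrite mulr_ge0 ?sqr_ge0 ?inner_ge0.
    by rewrite mulr_ge0//; exact: ltW.
  have := ler_wpM2l (ltW A'0) up.
  have -> : A' * (fx + - (alpha ^+ 2 / A') * pg + L / 2 *
    (- (alpha ^+ 2 / A') * (- (alpha ^+ 2 / A') * gg))) =
    A' * fx - alpha ^+ 2 * pg + A' * (L / 2 *
    (- (alpha ^+ 2 / A') * (- (alpha ^+ 2 / A') * gg))).
    by field; rewrite gt_eqF.
  lra.
have {}cvy := ler_wpM2l A0 cvy.
have {}cvxs := ler_wpM2l (ltW a0) cvxs.
have sq1 : 0 <= alpha ^+ 2 * inner (p + g) (p + g) by rewrite mulr_ge0 ?sqr_ge0 ?inner_ge0.
(* What remains is (101/200) |g|^2 - <p, g> <= (51/100) |g - p|^2, whose gap is (|g - 2 p|^2 + 98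
   |p|^2) / 200. *)
have sq2 : 0 <= alpha ^+ 2 * inner (g - p - p) (g - p - p).
  by rewrite mulr_ge0 ?sqr_ge0 ?inner_ge0.
have sq3 : 0 <= alpha ^+ 2 * pp by rewrite mulr_ge0 ?sqr_ge0 ?inner_ge0.
move: sq1 sq2; rewrite !innerE !(innerC g p) -/gg -/pg -/pp => sq1 sq2.
rewrite /A' in up *.
set a2 := alpha ^+ 2 in up sq1 sq2 sq3 *.
have -> : 51 / 100 * a2 * (gg - pg + (- pg - - pp)) =
   51 / 100 * (a2 * gg) - 102 / 100 * (a2 * pg) + 51 / 100 * (a2 * pp) by ring.
lra.
Qed.

(** For A > 0, |grad f y|^2 <= 2 L (f y - f xs) <= L r^2 / A <= q^2, and moving from y to x adds at
    most L |x - y| <= 2 L r alpha / (A + alpha). For A = 0 function values give no information, and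
    the gradient is compared with its zero at xs. *)
Lemma gradient_bound f L xs (A alpha r B : R) y z :
  0 < L -> l_smooth L f -> minimizer f xs -> 0 <= A -> 0 < alpha ->
  l2norm (y - xs) <= r -> l2norm (z - xs) <= r ->
  A * (f y - f xs) <= r ^+ 2 / 2 ->
  (A = 0 -> L * r <= B / (2 * alpha)) ->
  (0 < A -> exists2 q, 0 <= q & L * r ^+ 2 <= A * q ^+ 2 /\
    2 * L * r * alpha / (A + alpha) + q <= B / (2 * alpha)) ->
  l2norm (gradient f (wavg A alpha y z)) <= B / (2 * alpha).
Proof.
move=> L0 sf mf A0 a0 yr zr fr h0 h1.
have Aa : 0 < A + alpha by rewrite ltr_wpDl.
have [A_0|A_n0] := eqVneq A 0.
  apply: le_trans (h0 A_0).
  have -> : gradient f (wavg A alpha y z) = gradient f (wavg A alpha y z) - gradient f xs.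
    by rewrite (gradient_minimizer L0 sf mf) subr0.
  apply: le_trans (sf.2 _ _) _.
  by rewrite ler_pM2l// l2norm_wavg.
have A_0 : 0 < A by rewrite lt_def A_n0.
have [q q0 [h2 h3]] := h1 A_0.
apply: le_trans h3.
rewrite -[X in l2norm X](subrK (gradient f y)).
apply: le_trans (l2normD _ _) _; apply: lerD.
  apply: le_trans (sf.2 _ _) _.
  rewrite wavgB ?gt_eqF// subrr scaler0 add0r scalerA l2normZ.
  rewrite ger0_norm; last by rewrite mulr_ge0 ?invr_ge0//; exact: ltW.
  have -> : z - y = (z - xs) - (y - xs) by rewrite opprB addrA subrK.
  have e : 2 * L * r * alpha / (A + alpha) = L * ((A + alpha)^-1 * alpha * (r + r)) by field; rewrite gt_eqF.
  rewrite e ler_pM2l// ler_pM2l; last by rewrite mulr_gt0 ?invr_gt0.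
  by rewrite (le_trans (l2normB _ _))// lerD.
rewrite l2norm_le// (le_trans (sqr_gradient_le y L0 sf mf))//.
rewrite -(ler_pM2l A_0) (le_trans _ h2)//.
have := ler_wpM2l (ltW L0) fr; lra.
Qed.

(* The quadratic term collects the bias of clipping, the squared deviation and
   the second-order term of the exponential. *)
Lemma expR_clipped_increment (alpha r l R0 : R) p d u :
  0 < alpha -> 0 < R0 -> 0 < r -> 2 <= l -> r ^+ 2 = 5 * R0 ^+ 2 ->
  let B := r / (8 * l) in
  let g := clip u (B / alpha) in
  l2norm d <= r -> l2norm p <= B / (2 * alpha) ->
  expR (l / R0 ^+ 2 * (alpha * inner (g - p) d +
    51 / 100 * alpha ^+ 2 * inner (g - p) (g - p))) <=
  1 + l / R0 ^+ 2 * alpha * inner (u - p) d +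
    17 * l ^+ 2 * alpha ^+ 2 / R0 ^+ 2 * inner (u - p) (u - p).
Proof.
move=> a0 R00 r0 l2 rE B g dr pB.
have l0 : 0 < l by lra.
have B0 : 0 < B by rewrite divr_gt0 ?mulr_gt0.
have la0 : 0 < B / alpha by rewrite divr_gt0.
have pl2 : l2norm p <= B / alpha / 2 by rewrite -mulrA -invfM (mulrC alpha).
have pl : l2norm p <= B / alpha by rewrite (le_trans pl2)// ler_pdivrMr//; lra.
rewrite -!sqr_l2norm.
have ht : alpha * l2norm (g - p) <= alpha * l2norm (u - p).
  by rewrite ler_pM2l// clip_nonexpansive.
have hB : alpha * l2norm (g - p) <= 3 / 2 * B.
  rewrite mulrC -ler_pdivlMr// (le_trans (l2normB _ _))//.
  by have := l2norm_clip u la0; rewrite -/g; lra.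
have hD : alpha * inner (g - p) d <= alpha * l2norm (g - p) * r.
  rewrite -mulrA ler_pM2l// (le_trans (inner_le _ _))//.
  by rewrite ler_wpM2l// l2norm_ge0.
have hD' : - (alpha * l2norm (g - p) * r) <= alpha * inner (g - p) d.
  rewrite -mulrA -mulrN ler_pM2l// (le_trans _ (inner_ge _ _))// lerN2.
  by rewrite ler_wpM2l// l2norm_ge0.
have hbias : alpha * inner (g - p) d <= alpha * inner (u - p) d +
    (alpha * l2norm (u - p)) ^+ 2 * (r / (2 * B)).
  have -> : g - p = (u - p) + (g - u) by rewrite [RHS]addrC addrA subrK.
  rewrite innerDl mulrDr lerD2l.
  have -> : (alpha * l2norm (u - p)) ^+ 2 * (r / (2 * B)) =
    alpha * (l2norm (u - p) ^+ 2 / (2 * (B / alpha)) * r).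
    by field; rewrite !gt_eqF.
  rewrite ler_pM2l// (le_trans (inner_le _ _))//.
  by rewrite ler_pM ?l2norm_ge0// clip_bias.
have t0 : 0 <= alpha * l2norm (u - p) by rewrite mulr_ge0 ?l2norm_ge0// ltW.
have h0 : 0 <= alpha * l2norm (g - p) by rewrite mulr_ge0 ?l2norm_ge0// ltW.
have -> : 51 / 100 * alpha ^+ 2 * l2norm (g - p) ^+ 2 =
  51 / 100 * (alpha * l2norm (g - p)) ^+ 2 by ring.
have -> : 17 * l ^+ 2 * alpha ^+ 2 / R0 ^+ 2 * l2norm (u - p) ^+ 2 =
  17 * l ^+ 2 / R0 ^+ 2 * (alpha * l2norm (u - p)) ^+ 2 by ring.
have -> : l / R0 ^+ 2 * alpha * inner (u - p) d = l / R0 ^+ 2 * (alpha * inner (u - p) d) by ring.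
have rB : r / (2 * B) = 4 * l by rewrite /B; field; rewrite !gt_eqF.
rewrite rB in hbias.
move: ht hB hD hD' hbias t0 h0.
set h := alpha * l2norm (g - p); set t := alpha * l2norm (u - p).
set D := alpha * inner (g - p) d; set E := alpha * inner (u - p) d.
move=> ht hB hD hD' hbias t0 h0.
set X := D + 51 / 100 * h ^+ 2.
have r2E : R0 ^+ 2 = r ^+ 2 / 5 by rewrite rE; field.
rewrite r2E; set s := l / (r ^+ 2 / 5).
have s0 : 0 < s by rewrite divr_gt0// divr_gt0// exprn_gt0.
have Br : B <= r / 16 by rewrite ler_pM2l// lef_pV2 ?posrE ?mulr_gt0//; lra.
(* The clipping level is tuned here: B = r / (8 l) gives s * (8/5 * B * r) = 1 exactly. *)
have sX1 : s * X <= 1.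
  have e : s * (15 / 8 * B * r) = 75 / 64.
    by rewrite /s /B; field; rewrite !gt_eqF.
  have X1 : X <= 8 / 5 * B * r.
    have : h * r <= 3 / 2 * B * r by rewrite ler_pM2r.
    have : h ^+ 2 <= (3 / 2 * B) ^+ 2 by rewrite ler_sqr// nnegrE; lra.
    have : B * B <= B * (r / 16) by rewrite ler_pM2l.
    rewrite /X; lra.
  have : s * X <= s * (8 / 5 * B * r) by rewrite ler_pM2l.
  lra.
apply: (le_trans (expR_le_quadratic sX1)).
have hsq : h ^+ 2 <= t ^+ 2 by rewrite ler_sqr// nnegrE.
have Xsq : X ^+ 2 <= 6 / 5 * r ^+ 2 * t ^+ 2.
  have h1 : h <= r / 10 by lra.
  have : `|X| <= 107 / 100 * r * h.
    have : h ^+ 2 <= h * (r / 10) by rewrite expr2 ler_wpM2l.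
    have : 0 <= h ^+ 2 by exact: sqr_ge0.
    have : 0 <= h * r by rewrite mulr_ge0// ltW.
    by rewrite ler_norml /X => ? ? ?; apply/andP; split; lra.
  rewrite -(@ler_pXn2r _ 2)// ?nnegrE; last first.
    by have := mulr_ge0 (ltW r0) h0; lra.
  rewrite real_normK ?num_real//.
  move=> /le_trans; apply.
  have : r ^+ 2 * h ^+ 2 <= r ^+ 2 * t ^+ 2 by rewrite ler_wpM2l ?sqr_ge0.
  have : 0 <= r ^+ 2 * h ^+ 2 by rewrite mulr_ge0 ?sqr_ge0.
  rewrite !exprMn; lra.
have sXE : s * X <= s * E + (4 * l + 51 / 100) * s * t ^+ 2.
  have : X <= E + (4 * l + 51 / 100) * t ^+ 2 by rewrite /X; lra.
  move=> /(ler_wpM2l (ltW s0)); lra.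
have sX2 : 2 * (s * X) ^+ 2 <= 12 * l * s * t ^+ 2.
  have -> : 12 * l * s * t ^+ 2 = 2 * (s ^+ 2 * (6 / 5 * r ^+ 2 * t ^+ 2)).
    by rewrite /s; field; rewrite gt_eqF.
  by rewrite exprMn ler_pM2l// ler_pM2l// exprn_gt0.
have -> : 17 * l ^+ 2 / (r ^+ 2 / 5) * t ^+ 2 = 17 * l * (s * t ^+ 2).
  by rewrite /s; field; rewrite gt_eqF.
have st0 : 0 <= s * t ^+ 2 by rewrite mulr_ge0 ?sqr_ge0// ltW.
(* The coefficient 17 l covers 4 l from the bias, 12 l from the second-order term and 51/100 from
   the squared deviation, the last being at most l. *)
have : 2 * (s * t ^+ 2) <= l * (s * t ^+ 2) by rewrite ler_wpM2r.
lra.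
Qed.

End sstm_step.

(** * Independence of a state from unseen samples *)

Section independence.
Context {R : realType} {d dX : measure_display} {T : measurableType d}
  {Xi : measurableType dX} {P : probability T R} {I : eqType}.
Variable X : I -> {RV P >-> Xi}.
Local Open Scope ereal_scope.

Definition box_event (s : seq I) (E : I -> set Xi) : set T :=
  \bigcap_(i in [set` s]) (X i @^-1` E i).

(** Independence of W from the samples indexed by J, tested on finite boxes only: they form a
    pi-system generating the sigma-algebra of these samples, so that no filtration has to be
    built. *)
Definition indep_of_samples (dZ : measure_display) (Z : measurableType dZ)
    (J : set I) (W : T -> Z) : Prop :=
  forall (A : set Z) (s : seq I) (E : I -> set Xi), measurable A -> uniq s ->
    (forall i, i \in s -> J i) -> (forall i, i \in s -> measurable (E i)) ->
    P (W @^-1` A `&` box_event s E) = P (W @^-1` A) * P (box_event s E).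

Lemma measurable_sample_event i (E : set Xi) : measurable E ->
  measurable (X i @^-1` E).
Proof.
move=> mE; rewrite -[_ @^-1` _]setTI.
exact: (@measurable_funPT _ _ _ _ (X i)).
Qed.

Lemma box_event_nil E : box_event [::] E = setT.
Proof. by apply/seteqP; split. Qed.

Lemma box_event_cons i s E :
  box_event (i :: s) E = X i @^-1` E i `&` box_event s E.
Proof.
apply/seteqP; split => w /=.
  by move=> h; split => [|j js]; apply: h => /=; rewrite inE ?eqxx// js orbT.
by move=> [hi hs] j /=; rewrite inE => /orP[/eqP->//|]; exact: hs.
Qed.

Lemma measurable_box_event s E : (forall i, i \in s -> measurable (E i)) ->
  measurable (box_event s E).
Proof.
elim: s => [|i s ih] mE; first by rewrite box_event_nil.
rewrite box_event_cons; apply: measurableI.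
  by apply: measurable_sample_event; apply: mE; rewrite mem_head.
by apply: ih => j js; apply: mE; rewrite inE js orbT.
Qed.

Lemma indep_of_samples_cst (dZ : measure_display) (Z : measurableType dZ)
    (J : set I) (z : Z) : indep_of_samples J (cst z : T -> Z).
Proof.
move=> A s E mA us sJ mE; rewrite preimage_cst; case: ifP => _.
  by rewrite setTI probability_setT mul1e.
by rewrite set0I measure0 mul0e.
Qed.

Lemma indep_of_samples_comp (dZ dZ' : measure_display) (Z : measurableType dZ)
    (Z' : measurableType dZ') (J J' : set I) (W : T -> Z) (phi : Z -> Z') :
  measurable_fun setT phi -> J' `<=` J ->
  indep_of_samples J W -> indep_of_samples J' (phi \o W).
Proof.
move=> mphi JJ iW A s E mA us sJ mE; rewrite comp_preimage.
apply: iW => //; last by move=> i /sJ/JJ.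
by rewrite -[_ @^-1` _]setTI; exact: mphi.
Qed.

Section extend.
Context {dZ : measure_display} {Z : measurableType dZ}.
Variables (J J' : set I) (W : T -> Z) (j : I).
Hypothesis indepX : mutually_independent J X.
Hypothesis mW : measurable_fun setT W.
Hypothesis indepW : indep_of_samples J W.
Hypothesis Jj : J j.

Let WX (w : T) : Z * Xi := (W w, X j w).

Let mWX : measurable_fun setT WX.
Proof. exact: measurable_fun_pair. Qed.

Let WXm : {mfun T >-> (Z * Xi)%type} :=
  HB.pack WX (isMeasurableFun.Build _ _ _ _ _ mWX).

Let indepW1 A B : measurable A -> measurable B ->
  P (W @^-1` A `&` X j @^-1` B) = P (W @^-1` A) * P (X j @^-1` B).
Proof.
move=> mA mB; have := @indepW A [:: j] (fun=> B) mA erefl.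
rewrite box_event_cons box_event_nil setIT; apply => //.
by move=> i; rewrite inE => /eqP ->.
Qed.

(** For a fixed box F of remaining samples, S |-> P((W, X j) in S, F) and S |-> P((W, X j) in S)
    P(F) are finite measures that agree on rectangles, a pi-system generating the product
    sigma-algebra, hence are equal. *)
Lemma indep_of_samples_pair : J' `<=` J -> ~ J' j -> indep_of_samples J' WX.
Proof.
move=> J'J nJ'j A s E mA us sJ' mE.
have sJ i : i \in s -> J i by move=> /sJ'/J'J.
have mF := measurable_box_event mE.
set F := box_event s E in mF *.
have PFfin : P F \is a fin_num by exact: fin_num_measure.
have [m1 m1E] : exists m : {measure set (Z * Xi) -> \bar R},
    forall S, m S = P (WX @^-1` S `&` F).
  pose m : {measure set (Z * Xi) -> \bar R} := pushforward (mrestr P mF) WX.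
  by exists (m mWX).
pose c := NngNum (fine_ge0 (measure_ge0 P F)).
have [m2 m2E] : exists m : {measure set (Z * Xi) -> \bar R},
    forall S, m S = P (WX @^-1` S) * P F.
  exists (mscale c (distribution P WXm)) => S.
  by rewrite -[LHS]/((fine (P F))%:E * P (WX @^-1` S)) fineK// muleC.
rewrite -m1E -m2E.
pose C : set (set (Z * Xi)) :=
  [set C | exists A, measurable A /\ exists B, measurable B /\ C = A `*` B].
apply: (measure_unique C (fun=> setT)) => //.
- rewrite measurable_prod_measurableType //; congr (<<s _ >>).
  rewrite predeqE; split => [[A1 mA1 [B mB <-]]|[A1 [mA1 [B [mB ->]]]]].
    by exists A1; split => //; exists B.
  by exists A1 => //; exists B.
- move=> /= _ _ [X1 [mX1 [X2 [mX2 ->]]]] [Y1 [mY1 [Y2 [mY2 ->]]]].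
  rewrite -setXI; exists (X1 `&` Y1); split; first exact: measurableI.
  by exists (X2 `&` Y2); split => //; exact: measurableI.
- by move=> n; exists setT; split => //; exists setT; rewrite setXTT.
- by rewrite bigcup_const//; exists 0%N.
- move=> _ [A1 [mA1 [B [mB ->]]]].
  rewrite m1E m2E.
  have -> : WX @^-1` (A1 `*` B) = W @^-1` A1 `&` X j @^-1` B by [].
  rewrite indepW1//.
  pose E' i := if i == j then B else E i.
  have js : j \notin s by apply/negP => /sJ'.
  have F'E : X j @^-1` B `&` F = box_event (j :: s) E'.
    rewrite box_event_cons /E' eqxx; congr (_ `&` _).
    apply: eq_bigcapr => i /= si; case: ifPn => // /eqP ij.
    by rewrite -ij si in js.
  have mE' i : i \in j :: s -> measurable (E' i).
    by rewrite inE /E'; case: ifPn => //= _ /mE.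
  have Jjs i : i \in j :: s -> J i by rewrite inE => /orP[/eqP ->//|/sJ].
  have ujs : uniq (j :: s) by rewrite /= js.
  rewrite -setIA F'E indepW// -F'E.
  have -> : P (X j @^-1` B `&` F) = P (X j @^-1` B) * P F.
    rewrite F'E /F (indepX ujs Jjs mE') (indepX us sJ mE) big_cons /E' eqxx.
    congr (_ * _); apply: eq_big_seq => i si; case: ifPn => // /eqP ij.
    by rewrite -ij si in js.
  by rewrite muleA muleC.
- by move=> n; rewrite m1E preimage_setT setTI ltey_eq PFfin.
Qed.

(** Independence makes the law of (W, X j) the product of the law of W and D; this plays the part of
    conditioning on W. *)
Lemma integral_indep_sample (D : probability Xi R) (h : Z * Xi -> \bar R) :
  (forall E, measurable E -> distribution P (X j) E = D E) ->
  measurable_fun [set: Z * Xi] h -> (forall z, 0 <= h z) ->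
  \int[P]_w h (W w, X j w) = \int[P]_w \int[D]_x h (W w, x).
Proof.
move=> XD mh h0.
pose Wm : {mfun T >-> Z} := HB.pack W (isMeasurableFun.Build _ _ _ _ _ mW).
have -> : \int[P]_w h (W w, X j w) = \int[distribution P WXm]_z h z.
  by rewrite ge0_integral_pushforward.
have -> : \int[distribution P WXm]_z h z =
    \int[distribution P Wm \x D]_z h z.
  apply: eq_measure_integral => S mS _; apply/esym.
  apply: product_measure_unique => // A B mA mB.
  have := indepW1 mA mB.
  by rewrite -[P (X j @^-1` B)]/(distribution P (X j) B) XD.
rewrite fubini_tonelli1// ge0_integral_pushforward//.
- exact: measurable_fun_fubini_tonelli_F.
- by move=> z _; exact: integral_ge0.
Qed.

End extend.
End independence.

(** * Measurability of vector-valued maps *)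

Definition row_of_tuple (R : realType) (n : nat) (t : n.-tuple R) : 'rV[R]_n :=
  \row_(i < n) tnth t i.

Definition tuple_of_row (R : realType) (n : nat) (v : 'rV[R]_n) : n.-tuple R :=
  [tuple v 0 i | i < n].

Lemma tuple_of_rowK (R : realType) (n : nat) :
  cancel (@tuple_of_row R n) (@row_of_tuple R n).
Proof. by move=> v; apply/rowP => i; rewrite mxE tnth_mktuple. Qed.

Definition measurable_vec (R : realType) (n : nat) (d : measure_display)
    (T : measurableType d) (g : T -> 'rV[R]_n) : Prop :=
  forall i, measurable_fun setT (fun t => g t 0 i).

Section measurable_vec.
Context {R : realType} {n : nat} {d : measure_display} {T : measurableType d}.
Implicit Types (g h : T -> 'rV[R]_n) (c k : T -> R).

Lemma measurable_le_set c k : measurable_fun setT c -> measurable_fun setT k ->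
  measurable [set t | c t <= k t].
Proof.
move=> mc mk; have := measurable_fun_ler mc mk.
move=> /(_ measurableT [set true]); rewrite setTI; apply.
exact: I.
Qed.

Lemma measurable_lt_set c k : measurable_fun setT c -> measurable_fun setT k ->
  measurable [set t | c t < k t].
Proof.
move=> mc mk; have := measurable_fun_ltr mc mk.
move=> /(_ measurableT [set true]); rewrite setTI; apply.
exact: I.
Qed.

Lemma measurable_vec_cst (v : 'rV[R]_n) : measurable_vec (fun _ : T => v).
Proof. by move=> i; exact: measurable_cst. Qed.

Lemma measurable_vecD g h : measurable_vec g -> measurable_vec h ->
  measurable_vec (fun t => g t + h t).
Proof.
move=> mg mh i; under eq_fun do rewrite mxE.
exact: measurable_funD.
Qed.

Lemma measurable_vecN g : measurable_vec g -> measurable_vec (fun t => - g t).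
Proof.
move=> mg i; under eq_fun do rewrite mxE.
exact: measurable_funN.
Qed.

Lemma measurable_vecB g h : measurable_vec g -> measurable_vec h ->
  measurable_vec (fun t => g t - h t).
Proof. by move=> mg mh; apply: measurable_vecD => //; exact: measurable_vecN. Qed.

Lemma measurable_vecZ c g : measurable_fun setT c -> measurable_vec g ->
  measurable_vec (fun t => c t *: g t).
Proof.
move=> mc mg i; under eq_fun do rewrite mxE.
exact: measurable_funM.
Qed.

Lemma measurable_vec_tuple g : measurable_vec g ->
  measurable_fun setT (fun t => tuple_of_row (g t)).
Proof.
move=> mg; apply/measurable_fun_tnthP => i.
by rewrite (_ : _ \o _ = fun t => g t 0 i)//; apply/funext => t /=; rewrite tnth_mktuple.
Qed.

Lemma measurable_vec_row (h : T -> n.-tuple R) : measurable_fun setT h ->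
  measurable_vec (fun t => row_of_tuple (h t)).
Proof.
move=> mh i; under eq_fun do rewrite mxE.
exact: (measurableT_comp (measurable_tnth i)).
Qed.

Lemma measurable_inner g h : measurable_vec g -> measurable_vec h ->
  measurable_fun setT (fun t => inner (g t) (h t)).
Proof.
move=> mg mh; apply: measurable_sum => i.
exact: measurable_funM.
Qed.

(** The power with exponent -1 is 0 at 0, as the inverse is, so the norm inside [clip] may
    vanish. *)
Lemma measurable_fun_inv_ge0 c : measurable_fun setT c -> (forall t, 0 <= c t) ->
  measurable_fun setT (fun t => (c t)^-1).
Proof.
move=> mc c0; have -> : (fun t => (c t)^-1) = (fun t => (c t) `^ (-1)).
  by apply/funext => t; rewrite powR_inv1.
exact: (@measurableT_comp _ _ _ _ _ _ (fun x : R => x `^ (-1))).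
Qed.

Lemma measurable_l2norm g : measurable_vec g ->
  measurable_fun setT (fun t => l2norm (g t)).
Proof.
move=> mg; have -> : (fun t => l2norm (g t)) = (fun t => (inner (g t) (g t)) `^ 2^-1).
  by apply/funext => t; rewrite powR12_sqrt ?inner_ge0// -sqr_l2norm sqrtr_sqr ger0_norm ?l2norm_ge0.
apply: (@measurableT_comp _ _ _ _ _ _ (fun x : R => x `^ 2^-1)) => //.
exact: measurable_inner.
Qed.

Lemma measurable_clip g (lambda : R) : measurable_vec g ->
  measurable_vec (fun t => clip (g t) lambda).
Proof.
move=> mg; apply: measurable_vecZ => //; apply: measurable_minr.
  exact: measurable_cst.
apply: measurable_funM; first exact: measurable_cst.
apply: measurable_fun_inv_ge0; first exact: measurable_l2norm.
by move=> t; exact: l2norm_ge0.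
Qed.

End measurable_vec.

Section measurable_continuous.
Context {R : realType} {n : nat}.

Let round (p : nat) (t : n.-tuple R) : {ffun 'I_n -> int} :=
  [ffun i => Num.floor (tnth t i * p.+1%:R)].

Let grid (p : nat) (q : {ffun 'I_n -> int}) : 'rV[R]_n :=
  \row_i ((q i)%:~R / p.+1%:R).

Let measurable_round p q : measurable [set t | round p t = q].
Proof.
have -> : [set t | round p t = q] = \bigcap_(i in [set: 'I_n])
    ([set t | (q i)%:~R <= tnth t i * p.+1%:R] `&`
     [set t | tnth t i * p.+1%:R < (q i + 1)%:~R]).
  apply/seteqP; split => t /=.
    move=> <- i _ /=; rewrite ffunE; split; first exact: ge_floor.
    exact: floorD1_gt.
  move=> h; apply/ffunP => i; rewrite ffunE; apply: floor_def.
  by have [/= -> ->] := h i I.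
have mt (i : 'I_n) : measurable_fun setT (fun t : n.-tuple R => tnth t i * p.+1%:R).
  apply: measurable_funM; first exact: measurable_tnth.
  exact: measurable_cst.
apply: fin_bigcap_measurable => // i _; apply: measurableI.
  by apply: measurable_le_set => //; exact: measurable_cst.
by apply: measurable_lt_set => //; exact: measurable_cst.
Qed.

Let round_dist p t : `|row_of_tuple t - grid p (round p t)| <= p.+1%:R^-1.
Proof.
rewrite [leLHS]/Num.Def.normr/= mx_normrE; apply/bigmax_leP; split => //.
move=> [i j] _ /=; rewrite !mxE ffunE.
set x := tnth t j; have p0 : 0 < p.+1%:R :> R by rewrite ltr0n.
have -> : x - (Num.floor (x * p.+1%:R))%:~R / p.+1%:R =
  (x * p.+1%:R - (Num.floor (x * p.+1%:R))%:~R) / p.+1%:R.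
  by rewrite mulrBl mulfK ?gt_eqF.
have h1 := ge_floor (x * p.+1%:R); have h2 := floorD1_gt (x * p.+1%:R).
rewrite ger0_norm; last by rewrite divr_ge0// subr_ge0.
rewrite ler_pdivrMr// mulVf ?gt_eqF// lerBlDl ltW//.
by rewrite (lt_le_trans h2)// rmorphD/=.
Qed.

(* Rounding to a grid approximates phi pointwise by functions taking countably
   many values, each on a measurable set. *)
Lemma measurable_continuous_row (phi : 'rV[R]_n -> R) : continuous phi ->
  measurable_fun setT (fun t : n.-tuple R => phi (row_of_tuple t)).
Proof.
move=> cphi.
apply: (@measurable_fun_cvg _ _ _ _ (fun p t => phi (grid p (round p t)))).
  move=> p _ B mB; rewrite setTI.
  have -> : (fun t => phi (grid p (round p t))) @^-1` B =
    \bigcup_q [set t | round p t = q /\ B (phi (grid p q))].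
    apply/seteqP; split => t /=; first by move=> Bt; exists (round p t).
    by move=> [q _ /= [->]].
  apply: countable_bigcupT_measurable; first exact: countableP.
  move=> q; have [Bq|Bq] := pselect (B (phi (grid p q))).
    by rewrite (_ : [set _ | _] = [set t | round p t = q])//; apply/seteqP; split => t /= [].
  by rewrite (_ : [set _ | _] = set0)//; apply/seteqP; split => t /= [].
move=> t _; apply: (@cvg_comp _ _ _ (fun p => grid p (round p t)) phi _ (nbhs (row_of_tuple t))); last exact: cphi.
apply/cvgrPdist_le => e e0; near=> p.
apply: (le_trans (round_dist p t)); apply: ltW.
by near: p; exact: near_infty_natSinv_lt (PosNum e0).
Unshelve. all: by end_near. Qed.

Lemma measurable_continuous_vec (d : measure_display) (T : measurableType d)
    (phi : 'rV[R]_n -> R) (g : T -> 'rV[R]_n) :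
  continuous phi -> measurable_vec g -> measurable_fun setT (fun t => phi (g t)).
Proof.
move=> cphi mg.
have -> : (fun t => phi (g t)) =
    (fun t => phi (row_of_tuple t)) \o (fun t => tuple_of_row (g t)).
  by apply/funext => t /=; rewrite tuple_of_rowK.
apply: measurableT_comp; first exact: measurable_continuous_row.
exact: measurable_vec_tuple.
Qed.

End measurable_continuous.

Lemma measurable_oracle (R : realType) (n : nat) (d dX : measure_display)
    (T : measurableType d) (Xi : measurableType dX)
    (G : 'rV[R]_n -> Xi -> 'rV[R]_n) (g : T -> 'rV[R]_n) (X : T -> Xi) :
  oracle_measurable G -> measurable_vec g -> measurable_fun setT X ->
  measurable_vec (fun t => G (g t) (X t)).
Proof.
move=> mG mg mX i.
have -> : (fun t => G (g t) (X t) 0 i) =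
    (fun p => G (row_of_tuple p.1) p.2 0 i) \o (fun t => (tuple_of_row (g t), X t)).
  by apply/funext => t /=; rewrite tuple_of_rowK.
apply: measurableT_comp; first exact: mG.
apply: measurable_fun_pair => //; exact: measurable_vec_tuple.
Qed.

Lemma measurable_gradient (R : realType) (n : nat) (d : measure_display)
    (T : measurableType d) (f : 'rV[R]_n -> R) (L : R) (g : T -> 'rV[R]_n) :
  0 < L -> l_smooth L f -> measurable_vec g ->
  measurable_vec (fun t => gradient f (g t)).
Proof.
move=> L0 sf mg i.
apply: (@measurable_continuous_vec _ _ _ _ (fun x => gradient f x 0 i)) => //.
exact: continuous_gradient sf.
Qed.

(** * Processes driven by batches of samples *)

Section batch_process.
Context {R : realType} {d dX dZ dV : measure_display} {T : measurableType d}
  {Xi : measurableType dX} {Z : measurableType dZ} {V : measurableType dV}.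
Context {P : probability T R} {D : probability Xi R}.
Variables (N : nat) (m : nat -> nat) (xi : nat -> nat -> {RV P >-> Xi}).
Variables (z0 : Z) (v0 : V) (H : nat -> Z * V * Xi -> V) (F : nat -> Z * V -> Z).

(** [H] feeds one sample of the current batch to the accumulator and [F] closes the iteration. The
    state z stays fixed while its batch is read, and each sample enters alone, so it can be
    integrated alone. *)
Fixpoint batch_acc (k i : nat) (z : Z) (s : nat -> Xi) : V :=
  if i is j.+1 then H k ((z, batch_acc k j z s), s j) else v0.

Fixpoint batch_process (s : nat -> nat -> Xi) (k : nat) : Z :=
  if k is j.+1 then
    F j (batch_process s j, batch_acc j (m j) (batch_process s j) (s j))
  else z0.

Hypothesis iid : iid_samples D N m xi.
Hypothesis mH : forall k, measurable_fun [set: Z * V * Xi] (H k).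
Hypothesis mF : forall k, measurable_fun [set: Z * V] (F k).

(** [Psi k] is the bounding function at the start of iteration k, and [psi k i] the one after i
    samples of its batch. *)
Variables (psi : nat -> nat -> Z * V -> R) (Psi : nat -> Z -> R).
Hypothesis mpsi : forall k i, measurable_fun [set: Z * V] (psi k i).
Hypothesis mPsi : forall k, measurable_fun [set: Z] (Psi k).
Hypothesis psi_ge0 : forall k i u, 0 <= psi k i u.
Hypothesis Psi_ge0 : forall k z, 0 <= Psi k z.
Hypothesis psi_sample : forall k i z v, (k < N)%N -> (i < m k)%N ->
  (\int[D]_x (psi k i.+1 (z, H k ((z, v), x)))%:E <= (psi k i (z, v))%:E)%E.
Hypothesis psi_end : forall k z v, (k < N)%N ->
  Psi k.+1 (F k (z, v)) <= psi k (m k) (z, v).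
Hypothesis psi_begin : forall k z, (k < N)%N -> psi k 0%N (z, v0) <= Psi k z.

Let X (q : nat * nat) := xi q.1 q.2.

(** The samples at or after position (k, i) in the lexicographic order in which the method reads
    them. *)
Let unseen (k i : nat) : set (nat * nat) :=
  [set q | [/\ (q.1 < N)%N, (q.2 < m q.1)%N &
    (k < q.1)%N || ((q.1 == k) && (i <= q.2)%N)]].

Let indepX k i : mutually_independent (unseen k i) X.
Proof. by move=> s E us sJ mE; apply: iid.2 => // q /sJ []. Qed.

Let unseenW k i j : (i <= j)%N -> unseen k j `<=` unseen k i.
Proof.
move=> ij [a b] [/= h1 h2 h3]; split => //=.
by case/orP: h3 => [->//|/andP[-> jb]]; rewrite (leq_trans ij jb) orbT.
Qed.

Let unseenS k i : unseen k.+1 i `<=` unseen k (m k).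
Proof.
move=> [a b] [/= h1 h2 h3]; split => //=; apply/orP; left.
by case/orP: h3 => [/ltnW//|/andP[/eqP -> _]].
Qed.

Let acc k i (W : T -> Z) w : Z * V := (W w, batch_acc k i (W w) (xi k ^~ w)).

Let measurable_acc k i (W : T -> Z) : measurable_fun setT W ->
  measurable_fun setT (acc k i W).
Proof.
move=> mW; apply: measurable_fun_pair => //.
elim: i => [|i ih] /=; first exact: measurable_cst.
apply: (@measurableT_comp _ _ _ _ _ _ (H k)) => //.
apply: measurable_fun_pair => //; exact: measurable_fun_pair.
Qed.

Let accS k i (W : T -> Z) :
  acc k i.+1 W = (fun u : Z * V * Xi => (u.1.1, H k u)) \o (fun w => (acc k i W w, X (k, i) w)).
Proof. by []. Qed.

Let measurable_accS k : measurable_fun setT (fun u : Z * V * Xi => (u.1.1, H k u)).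
Proof.
apply: measurable_fun_pair => //.
by apply: (@measurableT_comp _ _ _ _ _ _ fst).
Qed.

(** Reading sample (k, i) moves it from the unseen set into the accumulator; the enlarged state is
    still independent of the rest. *)
Let indep_acc k i (W : T -> Z) : (k < N)%N -> (i <= m k)%N ->
  measurable_fun setT W -> indep_of_samples X (unseen k 0) W ->
  indep_of_samples X (unseen k i) (acc k i W).
Proof.
move=> kN im mW iW; elim: i im => [|i ih] im.
  apply: (@indep_of_samples_comp _ _ _ _ _ P _ X _ _ _ _ (unseen k 0) _ W (fun z => (z, v0))) => //.
rewrite accS.
apply: (@indep_of_samples_comp _ _ _ _ _ P _ X _ _ _ _ (unseen k i.+1)) => //.
apply: (@indep_of_samples_pair _ _ _ _ _ P _ X _ _ (unseen k i)) => //.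
- exact: measurable_acc.
- exact/ih/ltnW.
- by split => //=; rewrite eqxx leqnn orbT.
- exact: unseenW.
- by move=> [/= _ _]; rewrite ltnn eqxx ltnn.
Qed.

Let integral_acc k i (W : T -> Z) : (k < N)%N -> (i <= m k)%N ->
  measurable_fun setT W -> indep_of_samples X (unseen k 0) W ->
  (\int[P]_w (psi k i (acc k i W w))%:E <= \int[P]_w (psi k 0%N (W w, v0))%:E)%E.
Proof.
move=> kN im mW iW; elim: i im => [|i ih] im; first by [].
apply: le_trans (ih (ltnW im)).
pose h (u : Z * V * Xi) : \bar R := (psi k i.+1 (u.1.1, H k u))%:E.
have mh : measurable_fun setT h.
  apply/measurable_EFinP; apply: (@measurableT_comp _ _ _ _ _ _ (psi k i.+1)) => //.
have -> : (\int[P]_w (psi k i.+1 (acc k i.+1 W w))%:E =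
    \int[P]_w h (acc k i W w, X (k, i) w))%E by [].
rewrite (@integral_indep_sample _ _ _ _ _ P _ X _ _ (unseen k i) _ (k, i) _ _ _ D)//.
- apply: ge0_le_integral => //.
  + by move=> w _; apply: integral_ge0 => x _; rewrite lee_fin.
  + apply: (@measurableT_comp _ _ _ _ _ _ (fun u => \int[D]_x h (u, x))%E).
      apply: measurable_fun_fubini_tonelli_F => //.
      by move=> u; rewrite lee_fin.
    exact: measurable_acc.
  + apply/measurable_EFinP; apply: (@measurableT_comp _ _ _ _ _ _ (psi k i)) => //.
    exact: measurable_acc.
  + by move=> w _; exact: psi_sample.
- exact: measurable_acc.
- by apply: indep_acc => //; exact: ltnW.
- by split => //=; rewrite eqxx leqnn orbT.
- by move=> E mE; exact: iid.1.
- by move=> u; rewrite lee_fin.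
Qed.

Let process k w := batch_process (fun k i => xi k i w) k.

Lemma measurable_batch_process k :
  measurable_fun setT (fun w => batch_process (fun k i => xi k i w) k).
Proof.
elim: k => [|k ih]; first exact: measurable_cst.
apply: (@measurableT_comp _ _ _ _ _ _ (F k)) => //.
exact: (measurable_acc k (m k)).
Qed.

Let indep_process k : (k <= N)%N -> indep_of_samples X (unseen k 0) (process k).
Proof.
elim: k => [|k ih] kN; first exact: indep_of_samples_cst.
apply: (@indep_of_samples_comp _ _ _ _ _ P _ X _ _ _ _ (unseen k (m k)) _ (acc k (m k) (process k)) (F k)) => //.
apply: indep_acc => //; first exact: measurable_batch_process.
exact/ih/ltnW.
Qed.

(* Independence of the samples makes Psi along the process a supermartingale. *)
Lemma integral_batch_process : (\int[P]_w
  (Psi N (batch_process (fun k i => xi k i w) N))%:E <= (Psi 0%N z0)%:E)%E.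
Proof.
suff h k : (k <= N)%N -> (\int[P]_w (Psi k (process k w))%:E <= (Psi 0%N z0)%:E)%E by exact: h.
elim: k => [|k ih] kN.
  have -> : (\int[P]_w (Psi 0%N (process 0%N w))%:E =
      \int[P]_w (cst (Psi 0%N z0)%:E w))%E by [].
  by rewrite integral_cst//= probability_setT mule1.
have mP := measurable_batch_process k.
have kN' := ltnW kN.
apply: le_trans (ih kN').
apply: (@le_trans _ _ (\int[P]_w (psi k (m k) (acc k (m k) (process k) w))%:E)%E).
  apply: ge0_le_integral => //.
  - by move=> w _; rewrite lee_fin.
  - apply/measurable_EFinP; apply: (@measurableT_comp _ _ _ _ _ _ (Psi k.+1)) => //.
    exact: measurable_batch_process.
  - apply/measurable_EFinP; apply: (@measurableT_comp _ _ _ _ _ _ (psi k (m k))) => //.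
    exact: measurable_acc.
  - by move=> w _; rewrite lee_fin; exact: psi_end.
apply: le_trans (integral_acc kN (leqnn _) mP (indep_process kN')) _.
apply: ge0_le_integral => //.
- by move=> w _; rewrite lee_fin.
- apply/measurable_EFinP; apply: (@measurableT_comp _ _ _ _ _ _ (psi k 0%N)) => //.
  exact: measurable_fun_pair.
- apply/measurable_EFinP; exact: (@measurableT_comp _ _ _ _ _ _ (Psi k)).
- by move=> w _; rewrite lee_fin; exact: psi_begin.
Qed.

End batch_process.

(** * Moments of the stochastic gradient noise *)

Section oracle_moments.
Context {R : realType} {n : nat} {dX : measure_display} {Xi : measurableType dX}.
Variables (D : probability Xi R) (f : 'rV[R]_n -> R).
Variables (G : 'rV[R]_n -> Xi -> 'rV[R]_n) (sigma : R).
Hypotheses (mG : oracle_measurable G) (uG : unbiased D f G).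
Hypothesis vG : variance_bounded D f G sigma.

Let noise x xi := G x xi - gradient f x.

Lemma measurable_oracle_sample x : measurable_vec (G x).
Proof.
apply: (@measurable_oracle _ _ _ _ _ _ G (fun=> x) id) => //.
Qed.

Let mnoise x : measurable_vec (noise x).
Proof.
apply: measurable_vecB; first exact: measurable_oracle_sample.
exact: measurable_vec_cst.
Qed.

Let integral_sqr_noise x :
  (\int[D]_xi (inner (noise x xi) (noise x xi))%:E <= (sigma ^+ 2)%:E)%E.
Proof.
have := vG x; rewrite unlock; under eq_integral do rewrite sqr_l2norm.
by [].
Qed.

Let integrable_sqr_noise x :
  D.-integrable setT (EFin \o (fun xi => inner (noise x xi) (noise x xi))).
Proof.
apply/integrableP; split.
  by apply/measurable_EFinP; exact: measurable_inner.
under eq_integral do rewrite /= ger0_norm ?inner_ge0//.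
exact: le_lt_trans (integral_sqr_noise x) (ltry _).
Qed.

Let integrable_cst (c : R) : D.-integrable setT (EFin \o (fun _ : Xi => c)).
Proof. exact: finite_measure_integrable_cst. Qed.

(** Each coordinate is dominated by 1 + |noise|^2, integrable by the variance bound. *)
Let integrable_noise x i : D.-integrable setT (EFin \o (fun xi => noise x xi 0 i)).
Proof.
have h : D.-integrable setT
    ((EFin \o (fun _ : Xi => 1%R)) \+
     (EFin \o (fun xi => inner (noise x xi) (noise x xi))))%E by exact: integrableD.
apply: le_integrable h => //; first by apply/measurable_EFinP; exact: mnoise.
move=> xi _ /=; rewrite lee_fin [leRHS]ger0_norm; last by rewrite addr_ge0// inner_ge0.
have := coord_le_l2norm (noise x xi) i; rewrite -sqr_l2norm => /le_trans; apply.
have := sqr_ge0 (l2norm (noise x xi) - 1); have := l2norm_ge0 (noise x xi); nra.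
Qed.

Let integral_noise x i : (\int[D]_xi (noise x xi 0%R i)%:E = 0)%E.
Proof.
have := uG x i; rewrite unlock.
have -> : (fun xi => (G x xi 0 i)%:E) =
    ((EFin \o (fun xi => noise x xi 0%R i)) \+ (EFin \o (fun=> gradient f x 0%R i)))%E.
  by apply/funext => xi; rewrite /= -EFinD /noise [in RHS]mxE [in RHS]mxE subrK.
rewrite integralD_EFin//.
have -> : (\int[D]_xi (EFin \o (fun=> gradient f x 0%R i)) xi = (gradient f x 0%R i)%:E)%E.
  have -> : (\int[D]_xi (EFin \o (fun=> gradient f x 0%R i)) xi =
    \int[D]_xi (cst (gradient f x 0%R i)%:E xi))%E by [].
  by rewrite integral_cst//= probability_setT mule1.
rewrite [X in (X + _)%E](_ : _ = \int[D]_xi (noise x xi 0%R i)%:E)%E//.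
by case: (\int[D]_xi _)%E => [r| |]//; rewrite -EFinD => -[h]; congr EFin; lra.
Qed.

(** The linear term averages to 0 by unbiasedness; q >= 0 lets the variance bound be applied to the
    quadratic one. *)
Lemma integral_quadratic_noise x (c q : R) (b : 'rV[R]_n) : 0 <= q ->
  (\int[D]_xi (c + inner b (G x xi - gradient f x) +
     q * inner (G x xi - gradient f x) (G x xi - gradient f x))%:E
   <= (c + q * sigma ^+ 2)%:E)%E.
Proof.
move=> q0.
pose l xi := (\sum_(i < n) (b 0%R i)%:E * (noise x xi 0%R i)%:E)%E.
have il : D.-integrable setT l.
  by apply: integrable_sum => // i _; apply: integrableZl => //; exact: integrable_noise.
have il0 : (\int[D]_xi l xi = 0)%E.
  rewrite integral_sum//; last by move=> i; apply: integrableZl => //; exact: integrable_noise.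
  rewrite big1// => i _; rewrite integralZl//.
  by rewrite (integral_noise x i) mule0.
  exact: integrable_noise.
pose qn xi := (q%:E * (inner (noise x xi) (noise x xi))%:E)%E.
have iq : D.-integrable setT qn.
  by apply: integrableZl => //; exact: integrable_sqr_noise.
have E : (fun xi => (c + inner b (G x xi - gradient f x) +
     q * inner (G x xi - gradient f x) (G x xi - gradient f x))%:E) =
    (((EFin \o (fun=> c)) \+ l) \+ qn)%E.
  apply/funext => xi; have lE : l xi = (inner b (noise x xi))%:E.
    by rewrite /l /inner -sumEFin; apply: eq_bigr => i _; rewrite EFinM.
  by rewrite /= lE /qn -EFinM -!EFinD.
rewrite E integralD//; last exact: integrableD.
rewrite integralD// il0 adde0 EFinD EFinM; apply: leeD.
  have -> : (\int[D]_xi (EFin \o (fun=> c)) xi = \int[D]_xi (cst c%:E xi))%E by [].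
  by rewrite integral_cst//= probability_setT mule1.
rewrite integralZl//; last exact: integrable_sqr_noise.
by apply: lee_wpmul2l; rewrite ?lee_fin//; exact: integral_sqr_noise.
Qed.

End oracle_moments.

(** * Step sizes and clipping levels *)

Section sstm_parameters.
Context {R : realType}.
Variables (a L l r : R).
Hypotheses (L0 : 0 < L) (r0 : 0 < r) (l2 : 2 <= l).
Hypothesis sqrt_a : 24 * l + 3 / 2 <= Num.sqrt a.

Let u := Num.sqrt a.

Let u0 : 0 < u.
Proof. by apply: (lt_le_trans _ sqrt_a); have := l2; lra. Qed.

Let aE : a = u ^+ 2.
Proof.
(* A negative a would have square root 0, against u > 0. *)
rewrite sqr_sqrtr// leNgt; apply/negP => /ltW/ler0_sqrtr a0.
by move: u0; rewrite /u a0 ltxx.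
Qed.

Lemma sstm_a_gt0 : 0 < a.
Proof. by rewrite aE exprn_gt0. Qed.

Lemma sstm_a_ge100 : 100 <= a.
Proof.
rewrite aE; have h : 49 <= u by apply: (le_trans _ sqrt_a); have := l2; lra.
by nra.
Qed.

Let a0 := sstm_a_gt0.

Lemma sstm_alpha_gt0 k : 0 < sstm_alpha a L k.+1.
Proof. by rewrite /= divr_gt0 ?mulr_gt0. Qed.

Lemma sstm_AE k : sstm_A a L k = k%:R * (k%:R + 3) / (4 * a * L).
Proof.
elim: k => [|k ih]; first by rewrite /= !mul0r.
by rewrite [LHS]/= ih -[k.+2]addn2 -[k.+1]addn1 !natrD; field; rewrite !gt_eqF.
Qed.

Lemma sstm_A_ge0 k : 0 <= sstm_A a L k.
Proof. by rewrite sstm_AE divr_ge0 ?mulr_ge0 ?addr_ge0// ltW. Qed.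

Lemma sqr_sstm_alpha_le k :
  100 * (L * sstm_alpha a L k.+1 ^+ 2) <= sstm_A a L k + sstm_alpha a L k.+1.
Proof.
rewrite -[leRHS]/(sstm_A a L k.+1) sstm_AE /= -[k.+2]addn2 -[k.+1]addn1 !natrD.
have k0 : 0 <= k%:R :> R by exact: ler0n.
set K := k%:R in k0 *.
rewrite ler_pdivlMr ?mulr_gt0//.
have -> : 100 * (L * ((K + 2) / (2 * a * L)) ^+ 2) * (4 * a * L) =
  100 * (K + 2) ^+ 2 / a by field; rewrite !gt_eqF.
have := sstm_a_ge100; rewrite ler_pdivrMr// => a100.
have h : (K + 2) ^+ 2 <= (K + 1) * (K + 1 + 3) by nra.
rewrite mulrC; apply: ler_pM => //; exact: sqr_ge0.
Qed.

(** Since alpha_1 = 1 / (a L), the claim reduces to 16 l <= a. *)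
Lemma sstm_clip_level0 : L * r <= r / (8 * l) / (2 * sstm_alpha a L 1).
Proof.
have l0 : 0 < l by apply: lt_le_trans l2.
have c0 := sstm_alpha_gt0 0.
rewrite ler_pdivlMr; last exact: mulr_gt0.
rewrite ler_pdivlMr ?mulr_gt0//=.
have -> : L * r * (2 * (2 / (2 * a * L))) * (8 * l) = r * (16 * l / a).
  by field; rewrite !gt_eqF.
rewrite -[leRHS]mulr1 ler_pM2l// ler_pdivrMr// mul1r aE.
have ul : 24 * l + 3 / 2 <= u := sqrt_a.
nra.
Qed.

(** The bound q dominates sqrt (L r^2 / A_(k+1)): with K = k + 1 this is 4 (K + 2)^2 <= 9 K (K + 3),
    an equality at K = 1, whence the factor 3. Dividing the last claim by L r / (K + 2) leaves 4 + 3
    u <= u^2 / (8 l) for u = sqrt a, which dictates the lower bound assumed on sqrt a. *)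
Lemma sstm_clip_level k : let q := 3 * L * r * Num.sqrt a / (k.+1%:R + 2) in
  [/\ 0 <= q, L * r ^+ 2 <= sstm_A a L k.+1 * q ^+ 2 &
   2 * L * r * sstm_alpha a L k.+2 / (sstm_A a L k.+1 + sstm_alpha a L k.+2) + q
    <= r / (8 * l) / (2 * sstm_alpha a L k.+2)].
Proof.
move=> q; have k1 : 1 <= k.+1%:R :> R by rewrite ler1n.
rewrite -[sstm_A _ _ _ + sstm_alpha _ _ _]/(sstm_A a L k.+2) !sstm_AE /sstm_alpha.
rewrite /q -/u -[k.+3]addn2 -[k.+2]addn1 !natrD.
set K := k.+1%:R in k1 *.
have l0 : 0 < l by apply: lt_le_trans l2.
have K2 : 0 < K + 2 by lra.
have K1 : 0 < K + 1 by lra.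
have K4 : 0 < K + 1 + 3 by lra.
split.
- by rewrite divr_ge0 ?mulr_ge0// ltW.
- rewrite aE.
  have -> : K * (K + 3) / (4 * u ^+ 2 * L) * (3 * L * r * u / (K + 2)) ^+ 2 =
    L * r ^+ 2 * (9 * K * (K + 3) / (4 * (K + 2) ^+ 2)).
    by field; rewrite !gt_eqF.
  rewrite -[leLHS]mulr1 ler_pM2l ?mulr_gt0 ?exprn_gt0//.
  rewrite ler_pdivlMr ?mulr_gt0 ?exprn_gt0// mul1r; nra.
- have -> : 2 * L * r * ((K + 2) / (2 * a * L)) /
     ((K + 1) * (K + 1 + 3) / (4 * a * L)) = L * r / (K + 2) * (4 * (K + 2) ^+ 2 / ((K + 1) * (K + 1 + 3))).
    by field; rewrite !gt_eqF.
  have -> : 3 * L * r * u / (K + 2) = L * r / (K + 2) * (3 * u) by field; rewrite gt_eqF.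
  have -> : r / (8 * l) / (2 * ((K + 2) / (2 * a * L))) =
     L * r / (K + 2) * (u ^+ 2 / (8 * l)).
    by rewrite -aE; field; rewrite !gt_eqF.
  rewrite -mulrDr ler_pM2l; last by rewrite !mulr_gt0 ?invr_gt0.
  have h1 : 4 * (K + 2) ^+ 2 / ((K + 1) * (K + 1 + 3)) <= 4.
    by rewrite ler_pdivrMr ?mulr_gt0//; nra.
  have h2 : 4 + 3 * u <= u ^+ 2 / (8 * l).
    have ul : 24 * l + 3 / 2 <= u := sqrt_a.
    rewrite ler_pdivlMr ?mulr_gt0//; nra.
  lra.
Qed.

End sstm_parameters.

(** * Exponential supermartingale of the clipped method *)

Section clipped_sstm_analysis.
Context {R : realType} {n : nat} {dX : measure_display} {Xi : measurableType dX}.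
Variables (D : probability Xi R) (f : 'rV[R]_n -> R)
  (G : 'rV[R]_n -> Xi -> 'rV[R]_n) (L sigma : R) (x0 xs : 'rV[R]_n).
Variables (a l : R) (N : nat) (m : nat -> nat).
Hypothesis pb : smooth_convex_problem D f G L sigma xs.
Let R0 := l2norm (x0 - xs).
Hypothesis R00 : 0 < R0.
Hypothesis l2 : 2 <= l.
Hypothesis sqrt_a : 24 * l + 3 / 2 <= Num.sqrt a.
Hypothesis m0 : forall k, (0 < m k)%N.
Hypothesis m_large : forall k, 1200 * sigma ^+ 2 * sstm_alpha a L k.+1 ^+ 2 * N%:R * l
  <= R0 ^+ 2 * (m k)%:R.

Let r := Num.sqrt 5 * R0.
Let B := r / (8 * l).
Let al k := sstm_alpha a L k.+1.
Let A k := sstm_A a L k.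
Let s := l / R0 ^+ 2.
Let q k := 17 * l ^+ 2 * al k ^+ 2 / R0 ^+ 2.
Let kappa := l / N%:R.
Let L0 : 0 < L := L_gt0 pb.
Let sf : l_smooth L f := f_smooth pb.
Let cf := f_convex pb.
Let mf : minimizer f xs := f_minimizer pb.

Let l0 : 0 < l.
Proof. by apply: lt_le_trans l2. Qed.

Let r0 : 0 < r.
Proof. by rewrite mulr_gt0// sqrtr_gt0. Qed.

Let rE : r ^+ 2 = 5 * R0 ^+ 2.
Proof. by rewrite exprMn sqr_sqrtr. Qed.

Let al0 k : 0 < al k.
Proof. exact: (sstm_alpha_gt0 L0 l2 sqrt_a). Qed.

Let A0 k : 0 <= A k.
Proof. exact: (sstm_A_ge0 L0 l2 sqrt_a). Qed.

Let q0 k : 0 <= q k.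
Proof.
apply: divr_ge0; last exact: sqr_ge0.
by apply: mulr_ge0; last exact: sqr_ge0; apply: mulr_ge0; last exact: sqr_ge0.
Qed.

Let s0 : 0 < s.
Proof. by rewrite divr_gt0// exprn_gt0. Qed.

Let state : measurableType _ := (n.-tuple R * n.-tuple R * R)%type.
Let vec : measurableType _ := (n.-tuple R)%type.

Let yc (z : state) : 'rV[R]_n := row_of_tuple z.1.1.
Let zc (z : state) : 'rV[R]_n := row_of_tuple z.1.2.
Let xc k (z : state) := wavg (A k) (al k) (yc z) (zc z).
Let pot k (z : state) := potential f xs (A k) (yc z) (zc z).
(** The potential controls |z - xs| but not |y - xs|, hence the third condition. The first one makes
    stopping irreversible. *)
Let good k (z : state) :=
  [&& z.2 <= r ^+ 2 / 2, pot k z <= r ^+ 2 / 2 & l2norm (yc z - xs) <= r].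

(** The accumulator holds the sum of the centred errors G - grad f, so that the moment bounds apply
    to it directly; the true gradient is added back before clipping. *)
Let step_g k (u : state * vec) : 'rV[R]_n :=
  clip (gradient f (xc k u.1) + (m k)%:R^-1 *: row_of_tuple u.2) (B / al k).
Let step_z k u := zc u.1 - al k *: step_g k u.
Let step_y k u := wavg (A k) (al k) (yc u.1) (step_z k u).
Let step_S k (u : state * vec) : R :=
  if good k u.1 then
    u.1.2 + (potential f xs (A k.+1) (step_y k u) (step_z k u) - pot k u.1)
  else u.1.2.

(* The third component accumulates the increments of the potential and is
   frozen as soon as the iterate leaves the good region. *)
Let F k (u : state * vec) : state :=
  (tuple_of_row (step_y k u), tuple_of_row (step_z k u), step_S k u).

Let H k (u : state * vec * Xi) : vec :=
  tuple_of_row (row_of_tuple u.1.2 + (G (xc k u.1.1) u.2 - gradient f (xc k u.1.1))).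

Let z0 : state :=
  (tuple_of_row x0, tuple_of_row x0, inner (x0 - xs) (x0 - xs) / 2).
Let v0 : vec := tuple_of_row 0.

Let process (sm : nat -> nat -> Xi) k := batch_process m z0 v0 H F sm k.

Let yz_process sm k :
  (yc (process sm k), zc (process sm k)) = clipped_sstm G L a B m x0 sm k.
Proof.
elim: k => [|k ih]; first by rewrite /yc /zc /= !tuple_of_rowK.
rewrite [RHS]/= -ih; set w := process sm k in ih *.
have accE i : row_of_tuple (batch_acc v0 H k i w (sm k)) =
    \sum_(j < i) (G (xc k w) (sm k j) - gradient f (xc k w)).
  elim: i => [|i ihi]; first by rewrite big_ord0 tuple_of_rowK.
  by rewrite /= tuple_of_rowK ihi big_ord_recr.
have gE : step_g k (w, batch_acc v0 H k (m k) w (sm k)) =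
    clip (batch_gradient G (m k) (sm k) (xc k w)) (B / al k).
  rewrite /step_g /= accE /batch_gradient; congr clip.
  rewrite sumrB sumr_const card_ord scalerBr.
  rewrite -[X in _ - _ *: X]scaler_nat scalerA mulVf ?scale1r 1?addrC ?subrK//.
  by rewrite pnatr_eq0 -lt0n.
have zE : zc (process sm k.+1) =
    zc w - al k *: clip (batch_gradient G (m k) (sm k) (xc k w)) (B / al k).
  by rewrite /zc /= tuple_of_rowK /step_z gE.
congr pair; last exact: zE.
by rewrite /yc /= tuple_of_rowK /step_y /step_z gE.
Qed.

(** If the final sum is at most r^2 / 2, no stop ever occurred, so the sum telescopes to the
    potential. This bounds |z^(k+1) - xs| by r, and y^(k+1) is an average of y^k and z^(k+1). *)
Let process_good sm k : (process sm N).2 <= r ^+ 2 / 2 -> (k <= N)%N ->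
  good k (process sm k) /\ (process sm k).2 = pot k (process sm k).
Proof.
move=> SN.
have S_le j : (j <= N)%N -> (process sm j).2 <= r ^+ 2 / 2.
  move=> jN; rewrite leNgt; apply/negP => Sj.
  (* [good] tests the sum itself, so a sum above r^2 / 2 fails the test at every later iteration and
     never changes. *)
  have frozen i : (process sm (j + i)).2 = (process sm j).2.
    elim: i => [|i ih]; first by rewrite addn0.
    rewrite addnS -ih /= /step_S /= /good -/(process sm (j + i)) ih.
    by rewrite leNgt Sj.
  by have := frozen (N - j)%N; rewrite subnKC// => E; move: Sj; rewrite -E ltNge SN.
elim: k => [|k ih] kN.
  have p0 : pot 0 (process sm 0) = (process sm 0).2.
    by rewrite /pot /potential /A /= mul0r add0r /zc /= tuple_of_rowK.
  split; last by rewrite p0.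
  rewrite /good S_le//= p0 S_le//= /yc /= tuple_of_rowK -/R0.
  have s5 : 1 <= Num.sqrt 5 :> R.
    by have := @ler_wsqrtr R 1 5; rewrite sqrtr1; apply; lra.
  by rewrite /r ler_peMl// ltW.
have [gk Sk] := ih (ltnW kN); have gk' := gk; case/and3P: gk' => _ pk yk.
have Sk1 : (process sm k.+1).2 = pot k.+1 (process sm k.+1).
  rewrite /= /step_S /= -/(process sm k) gk Sk addrC subrK.
  by rewrite /pot /yc /zc /= !tuple_of_rowK.
split => //; rewrite /good S_le//= -Sk1 S_le//=.
have zr (z : state) : pot k.+1 z <= r ^+ 2 / 2 -> l2norm (zc z - xs) <= r.
  rewrite /pot /potential => h; rewrite l2norm_le; last exact: ltW.
  have : 0 <= A k.+1 * (f (yc z) - f xs) by rewrite mulr_ge0// subr_ge0.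
  lra.
have z1 : l2norm (zc (process sm k.+1) - xs) <= r by apply: zr; rewrite -Sk1 S_le.
rewrite {1}/yc /= tuple_of_rowK; apply: l2norm_wavg => //.
by move: z1; rewrite /zc /= tuple_of_rowK.
Qed.

Let measurable_yc : measurable_vec yc.
Proof.
by apply: measurable_vec_row; apply: (@measurableT_comp _ _ _ _ _ _ fst).
Qed.

Let measurable_zc : measurable_vec zc.
Proof.
by apply: measurable_vec_row; apply: (@measurableT_comp _ _ _ _ _ _ snd).
Qed.

Let measurable_wavg (d : measure_display) (T : measurableType d) k
    (g h : T -> 'rV[R]_n) : measurable_vec g -> measurable_vec h ->
  measurable_vec (fun t => wavg (A k) (al k) (g t) (h t)).
Proof.
move=> mg mh; apply: measurable_vecZ => //.
by apply: measurable_vecD; exact: measurable_vecZ.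
Qed.

Let measurable_xc k : measurable_vec (xc k).
Proof. exact: measurable_wavg. Qed.

Let measurable_pot (d : measure_display) (T : measurableType d) k
    (g h : T -> 'rV[R]_n) : measurable_vec g -> measurable_vec h ->
  measurable_fun setT (fun t => potential f xs (A k) (g t) (h t)).
Proof.
move=> mg mh; apply: measurable_funD.
  apply: measurable_funM => //; apply: measurable_funB => //.
  apply: (@measurable_continuous_vec _ _ _ _ f) => //.
  exact: continuous_smooth sf.
apply: measurable_funM => //.
by apply: measurable_inner; apply: measurable_vecB => //; exact: measurable_vec_cst.
Qed.

Let measurable_good k : measurable_fun setT (good k).
Proof.
apply: measurable_and; first exact: measurable_fun_ler.
apply: measurable_and; first by apply: measurable_fun_ler => //; exact: measurable_pot.
apply: measurable_fun_ler => //; apply: measurable_l2norm.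
by apply: measurable_vecB => //; exact: measurable_vec_cst.
Qed.

Let measurable_fst_vec (d : measure_display) (T : measurableType d)
    (g : state -> 'rV[R]_n) (p : T -> state) : measurable_vec g ->
  measurable_fun setT p -> measurable_vec (g \o p).
Proof. by move=> mg mp i; exact: (measurableT_comp (mg i)). Qed.

Let measurable_step_z k : measurable_vec (step_z k).
Proof.
apply: measurable_vecB; first exact: measurable_fst_vec.
apply: measurable_vecZ => //; apply: measurable_clip; apply: measurable_vecD.
  apply: (@measurable_gradient _ _ _ _ _ L) => //.
  exact: (@measurable_fst_vec _ _ (xc k) fst).
by apply: measurable_vecZ => //; exact: measurable_vec_row.
Qed.

Let measurable_step_y k : measurable_vec (step_y k).
Proof. by apply: measurable_wavg => //; exact: measurable_fst_vec. Qed.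

Let measurable_F k : measurable_fun [set: state * vec] (F k).
Proof.
have m12 : measurable_fun [set: state * vec] (fun u => u.1.2).
  by apply: (@measurableT_comp _ _ _ _ _ _ snd).
apply: measurable_fun_pair.
  by apply: measurable_fun_pair; exact: measurable_vec_tuple.
apply: measurable_fun_ifT => //; first exact: measurableT_comp.
apply: measurable_funD => //; apply: measurable_funB; first exact: measurable_pot.
by apply: (@measurableT_comp _ _ _ _ _ _ (pot k)) => //; exact: measurable_pot.
Qed.

Let measurable_H k : measurable_fun [set: state * vec * Xi] (H k).
Proof.
have mx : measurable_vec (fun u : state * vec * Xi => xc k u.1.1).
  apply: (@measurable_fst_vec _ _ (xc k) (fun u : state * vec * Xi => u.1.1)) => //.
  by apply: (@measurableT_comp _ _ _ _ _ _ fst).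
apply: measurable_vec_tuple; apply: measurable_vecD.
  by apply: measurable_vec_row; apply: (@measurableT_comp _ _ _ _ _ _ snd).
apply: measurable_vecB; last exact: (@measurable_gradient _ _ _ _ _ L).
by apply: measurable_oracle => //; exact: G_measurable pb.
Qed.

Let dc (z : state) := xs - zc z.

(** The quadratic bound on the exponential of the coming increment, with the noise of the m - i
    unread samples replaced by its moments: mean 0 and (m - i) sigma^2. A stopped state has no
    increment, hence the factor 1. *)
Let psi k i (u : state * vec) : R :=
  expR (s * u.1.2 - k.+1%:R * kappa) *
  if good k u.1 then
    1 + s * al k / (m k)%:R * inner (row_of_tuple u.2) (dc u.1) +
    q k / (m k)%:R ^+ 2 * (inner (row_of_tuple u.2) (row_of_tuple u.2) +
      (m k - i)%:R * sigma ^+ 2)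
  else 1.

Let Psi k (z : state) : R := expR (s * z.2 - k%:R * kappa).

Let mk0 k : 0 < (m k)%:R :> R.
Proof. by rewrite ltr0n. Qed.

Let good_dc k z : good k z -> l2norm (dc z) <= r.
Proof.
case/and3P => _ + _; rewrite /pot /potential l2normBC => h.
rewrite l2norm_le; last exact: ltW.
have : 0 <= A k * (f (yc z) - f xs) by rewrite mulr_ge0// subr_ge0.
lra.
Qed.

(** Tonelli requires a nonnegative integrand although the linear term may be negative. With e = s
    alpha r |v| / m, the factor is at least 1 - e + (17/5) e^2 > 0. *)
Let psi_ge0 k i u : 0 <= psi k i u.
Proof.
rewrite mulr_ge0 ?expR_ge0//; case: ifPn => // /good_dc dr.
set v := row_of_tuple u.2; set M := (m k)%:R.
have M0 : 0 < M := mk0 k.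
pose e := s * al k / M * r * l2norm v.
have sM : 0 < s * al k / M by rewrite divr_gt0// mulr_gt0.
have h1 : - e <= s * al k / M * inner v (dc u.1).
  have -> : - e = s * al k / M * - (l2norm v * r) by rewrite /e; ring.
  rewrite ler_pM2l// (le_trans _ (inner_ge _ _))// lerN2.
  by rewrite ler_wpM2l ?l2norm_ge0.
have h2 : q k / M ^+ 2 * inner v v = 17 / 5 * e ^+ 2.
  rewrite -sqr_l2norm /q /e /s.
  have -> : 17 / 5 * (l / R0 ^+ 2 * al k / M * r * l2norm v) ^+ 2 =
    17 / 5 * (l / R0 ^+ 2 * al k / M * l2norm v) ^+ 2 * r ^+ 2 by ring.
  by rewrite rE; field; rewrite !gt_eqF.
have h3 : 0 <= q k / M ^+ 2 * ((m k - i)%:R * sigma ^+ 2).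
  rewrite mulr_ge0//; first by rewrite divr_ge0// sqr_ge0.
  by rewrite mulr_ge0// sqr_ge0.
rewrite mulrDr h2.
have := sqr_ge0 (e - 1); have := sqr_ge0 e; lra.
Qed.

Let psi_sample k i z v : (k < N)%N -> (i < m k)%N ->
  (\int[D]_x (psi k i.+1 (z, H k ((z, v), x)))%:E <= (psi k i (z, v))%:E)%E.
Proof.
move=> _ im; rewrite /psi /=; set E := expR _; have E0 : 0 <= E by exact: expR_ge0.
case: ifPn => gk; last first.
  have -> : (\int[D]_x (E * 1)%:E = \int[D]_x (cst (E * 1)%:E x))%E by [].
  by rewrite integral_cst//= probability_setT mule1.
set p := q k / _; set t := s * al k / _; set w := row_of_tuple v.
have p0 : 0 <= p by rewrite divr_ge0// sqr_ge0.
(* One sigma^2 of the remaining variance is set aside for the sample being integrated. *)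
have -> : (m k - i)%:R = (m k - i.+1)%:R + 1 :> R by rewrite natr1 subnSK.
set K := (m k - i.+1)%:R.
pose c := E * (1 + t * inner w (dc z) + p * (inner w w + K * sigma ^+ 2)).
pose b := E *: (t *: dc z + (2 * p) *: w).
have -> : (\int[D]_x (E * (1 + t * inner (row_of_tuple (H k (z, v, x))) (dc z) +
     p * (inner (row_of_tuple (H k (z, v, x))) (row_of_tuple (H k (z, v, x))) + K * sigma ^+ 2)))%:E =
   \int[D]_x (c + inner b (G (xc k z) x - gradient f (xc k z)) +
     E * p * inner (G (xc k z) x - gradient f (xc k z)) (G (xc k z) x - gradient f (xc k z)))%:E)%E.
  apply: eq_integral => x _; congr EFin.
  rewrite tuple_of_rowK /=; move: (G _ _ - _) => V.
  rewrite /b /c -/w; clear c b; rewrite /w; move: (dc z) (row_of_tuple v) => dd ww.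
  by rewrite !innerE (innerC V ww) (innerC dd V); ring.
apply: le_trans (integral_quadratic_noise (G_measurable pb) (G_unbiased pb)
  (G_variance pb) _ _ _ _) _; first by rewrite mulr_ge0.
by rewrite lee_fin /c le_eqVlt; apply/orP; left; apply/eqP; ring.
Qed.

Let gradient_le k z : good k z ->
  l2norm (gradient f (xc k z)) <= B / (2 * al k).
Proof.
move=> gk; have /and3P[_ pk yk] := gk.
apply: (@gradient_bound _ _ f L xs _ _ r) => //.
- by have := good_dc gk; rewrite /dc l2normBC.
- by move: pk; rewrite /pot /potential; have := inner_ge0 (zc z - xs); lra.
- case: k {gk pk yk} => [_|k Ak]; first exact: (sstm_clip_level0 L0 r0 l2 sqrt_a).
  suff : 0 < A k.+1 by rewrite Ak ltxx.
  rewrite /A (sstm_AE L0 l2 sqrt_a); have a0 := sstm_a_gt0 l2 sqrt_a.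
  by rewrite divr_gt0// mulr_gt0// ?addr_gt0// mulr_gt0.
- case: k {gk pk yk} => [|k _]; first by rewrite /A /= ltxx.
  have [h1 h2 h3] := sstm_clip_level L0 r0 l2 sqrt_a k.
  by exists (3 * L * r * Num.sqrt a / (k.+1%:R + 2)) => //; split.
Qed.

(** Once the batch is read no variance remains, and the quadratic factor is exactly the bound on the
    exponential of the increment. *)
Let psi_end k z v : (k < N)%N -> Psi k.+1 (F k (z, v)) <= psi k (m k) (z, v).
Proof.
move=> _; rewrite /Psi /psi /= /step_S /=; case: ifPn => gk; last by rewrite mulr1.
have -> : s * (z.2 + (potential f xs (A k.+1) (step_y k (z, v)) (step_z k (z, v)) - pot k z)) -
    k.+1%:R * kappa = (s * z.2 - k.+1%:R * kappa) +
    s * (potential f xs (A k.+1) (step_y k (z, v)) (step_z k (z, v)) - pot k z) by ring.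
rewrite expRD ler_pM2l ?expR_gt0//.
set w := row_of_tuple v; set p := gradient f (xc k z).
have h := potential_step xs (yc z) (zc z) (step_g k (z, v)) L0 sf cf (A0 k) (al0 k)
  (sqr_sstm_alpha_le L0 l2 sqrt_a k).
have wE : p + (m k)%:R^-1 *: w - p = (m k)%:R^-1 *: w by rewrite addrAC subrr add0r.
have := expR_clipped_increment (p + (m k)%:R^-1 *: w) (al0 k) R00 r0 l2 rE
  (good_dc gk) (gradient_le gk).
rewrite -/p wE => h'.
apply: le_trans (le_trans h' _); first by rewrite ler_expR ler_pM2l.
rewrite subnn mul0r addr0 !innerZl !innerZr -/s -/(q k).
rewrite le_eqVlt; apply/orP; left; apply/eqP; field.
by rewrite gt_eqF.
Qed.

(** The batch size enters here: the variance of the whole batch contributes q sigma^2 / m <= l / N =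
    kappa, and 1 + kappa <= exp kappa. *)
Let psi_begin k z : (k < N)%N -> psi k 0%N (z, v0) <= Psi k z.
Proof.
move=> kN; rewrite /psi /Psi /= tuple_of_rowK.
have N0 : 0 < N%:R :> R by rewrite ltr0n (leq_trans _ kN).
have kap0 : 0 <= kappa by rewrite divr_ge0// ltW.
have -> : s * z.2 - k%:R * kappa = (s * z.2 - k.+1%:R * kappa) + kappa.
  by rewrite -natr1; ring.
rewrite [X in _ <= X]expRD ler_pM2l ?expR_gt0//.
apply: le_trans (expR_ge1Dx kappa); case: ifPn => _; last by rewrite lerDl.
rewrite -(scale0r (0 : 'rV[R]_n)) !innerZl !mul0r mulr0 addr0 add0r lerD2l subn0.
have -> : q k / (m k)%:R ^+ 2 * ((m k)%:R * sigma ^+ 2) =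
    l * (17 * (sigma ^+ 2 * al k ^+ 2 * N%:R * l)) / (N%:R * R0 ^+ 2 * (m k)%:R).
  by rewrite /q; field; rewrite !gt_eqF.
rewrite ler_pdivrMr ?mulr_gt0 ?exprn_gt0//.
have -> : kappa * (N%:R * R0 ^+ 2 * (m k)%:R) = l * (R0 ^+ 2 * (m k)%:R).
  by rewrite /kappa; field; rewrite gt_eqF.
rewrite ler_pM2l//; apply: le_trans (m_large k).
have : 0 <= sigma ^+ 2 * al k ^+ 2 * N%:R * l.
  apply: mulr_ge0; last exact: ltW.
  by apply: mulr_ge0 => //; apply: mulr_ge0; exact: sqr_ge0.
rewrite -/(al k); lra.
Qed.


(** On the exit event [Psi N] is at least exp (3 l / 2), while its mean is at most exp (l / 2).
    Elsewhere A_N (f y^N - f xs) is at most the potential, hence at most 5 R0^2 / 2. *)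
Lemma clipped_sstm_tail (d : measure_display) (T : measurableType d)
    (P : probability T R) (xi : nat -> nat -> {RV P >-> Xi}) (c : R) :
  iid_samples D N m xi -> (0 < N)%N -> 5 * R0 ^+ 2 / 2 <= sstm_A a L N * c ->
  ((1 - expR (- l))%:E <= P [set w |
     (f (clipped_sstm_output G L a B m x0 (fun k i => xi k i w) N) - f xs <= c)%R])%E.
Proof.
move=> iid N0 hc; have N0' : 0 < N%:R :> R by rewrite ltr0n.
pose pr w := process (fun k i => xi k i w) N.
have mpr : measurable_fun setT pr.
  exact: measurable_batch_process.
have yE w : clipped_sstm_output G L a B m x0 (fun k i => xi k i w) N = yc (pr w).
  by rewrite /clipped_sstm_output -yz_process.
set S := [set w | _].
have mS : measurable S.
  apply: measurable_le_set => //; apply: measurable_funB => //.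
  under eq_fun do rewrite yE.
  apply: (@measurable_continuous_vec _ _ _ _ f) => //.
    exact: continuous_smooth sf.
  exact: (measurable_fst_vec measurable_yc mpr).
have mpr2 : measurable_fun setT (fun w => (pr w).2).
  exact: (@measurableT_comp _ _ _ _ _ _ snd).
pose E := [set w | r ^+ 2 / 2 < (pr w).2].
have mE : measurable E by exact: measurable_lt_set.
have ES : ~` E `<=` S.
  move=> w /= /negP; rewrite -leNgt => /process_good /(_ (leqnn N)) [gN _].
  have AN : 0 < A N.
    by case: (N) N0 => // k _; apply: (lt_le_trans (al0 k)); rewrite lerDr; exact: A0.
  have /and3P[_ + _] := gN; rewrite /S /= yE /pot /potential -/(pr w) rE.
  move=> h; rewrite -(ler_pM2l AN); apply: le_trans hc.
  by have := inner_ge0 (zc (pr w) - xs); rewrite -/(A N); lra.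
have mPsi k : measurable_fun [set: state] (Psi k).
  apply: (@measurableT_comp _ _ _ _ _ _ expR) => //.
  by apply: measurable_funB => //; exact: measurable_funM.
have mrow : measurable_vec (fun u : state * vec => row_of_tuple u.2).
  exact: measurable_vec_row.
have mpsi k i : measurable_fun [set: state * vec] (psi k i).
  have m12 : measurable_fun [set: state * vec] (fun u => u.1.2).
    by apply: (@measurableT_comp _ _ _ _ _ _ snd).
  apply: measurable_funM.
    apply: (@measurableT_comp _ _ _ _ _ _ expR) => //.
    by apply: measurable_funB => //; exact: measurable_funM.
  apply: measurable_fun_ifT => //; first exact: measurableT_comp.
  apply: measurable_funD.
    apply: measurable_funD => //; apply: measurable_funM => //.
    apply: measurable_inner => //; apply: measurable_vecB.
      exact: measurable_vec_cst.
    exact: (@measurable_fst_vec _ _ zc fst).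
  apply: measurable_funM => //; apply: measurable_funD => //.
  exact: measurable_inner.
have Psi_ge0 k z : 0 <= Psi k z by exact: expR_ge0.
have := integral_batch_process z0 iid measurable_H measurable_F mpsi mPsi
  psi_ge0 Psi_ge0 psi_sample psi_end psi_begin.
have -> : Psi 0%N z0 = expR (l / 2).
  rewrite /Psi mul0r subr0 /= -sqr_l2norm -/R0; congr expR.
  by rewrite /s; field; rewrite gt_eqF.
move=> hPsi.
have PE : (P E <= (expR (- l))%:E)%E.
  have e0 : 0 < expR (3 / 2 * l) by exact: expR_gt0.
  have : ((expR (3 / 2 * l))%:E * P E <= (expR (l / 2))%:E)%E.
    apply: le_trans hPsi.
    have -> : ((expR (3 / 2 * l))%:E * P E =
        \int[P]_w ((expR (3 / 2 * l))%:E * (\1_E w)%:E))%E.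
      rewrite ge0_integralZl//; first by rewrite integral_indic// setIT.
      exact/measurable_EFinP.
    apply: ge0_le_integral => //.
    - by apply: measurable_funeM; exact/measurable_EFinP.
    - by apply/measurable_EFinP; apply: (@measurableT_comp _ _ _ _ _ _ (Psi N)).
    - move=> w _; rewrite -EFinM lee_fin indicE; case: (boolP (w \in E)) => [|_]; last first.
        by rewrite mulr0 expR_ge0.
      rewrite inE /E /= mulr1 ler_expR -/(process _ N) -/(pr w) => wE.
      have -> : N%:R * kappa = l by rewrite /kappa; field; rewrite gt_eqF.
      have : s * (r ^+ 2 / 2) <= s * (pr w).2 by rewrite ler_pM2l// ltW.
      have -> : s * (r ^+ 2 / 2) = 5 / 2 * l by rewrite rE /s; field; rewrite gt_eqF.
      lra.
  have -> : expR (l / 2) = expR (3 / 2 * l) * expR (- l).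
    by rewrite -expRD; congr expR; field.
  by rewrite EFinM lee_pmul2l.
apply: (@le_trans _ _ (P (~` E))); last by rewrite le_measure// inE//; exact: measurableC.
by rewrite probability_setC// EFinB leeB.
Qed.

End clipped_sstm_analysis.

(** * Choice of parameters and complexity *)

Section parameter_choice.
Context {R : realType}.
Implicit Types (x l a beta : R) (N : nat).

Lemma ceiln_ge x : x <= (ceiln x)%:R.
Proof.
rewrite /ceiln natr_absz ger0_norm; last by rewrite ceil_ge0 (lt_le_trans (ltrN10 _))// le_max lexx.
by apply: le_trans (ceil_ge _); rewrite le_max lexx orbT.
Qed.

Lemma ceiln_le x : 0 <= x -> (ceiln x)%:R <= x + 1.
Proof.
move=> x0; rewrite /ceiln (max_idPr x0) natr_absz ger0_norm; last by rewrite ceil_ge0 (lt_le_trans _ x0)// ltrN10.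
by have := ltW (ceilB1_lt x); rewrite rmorphB/= lerBlDr.
Qed.

Definition stepsize_of_ln l : R :=
  Num.max 1 (Num.max (16 * l / Num.sqrt 5)
    (36 * (2 * l + Num.sqrt (4 * l ^+ 2 + 2 * l)) ^+ 2)).

(** For l >= 2, sqrt (4 l^2 + 2 l) >= 2 l + 1/4, so the last term of the maximum is at least (6 (4 l
    + 1/4))^2. *)
Lemma le_sqrt_stepsize l a : 2 <= l -> stepsize_of_ln l <= a ->
  24 * l + 3 / 2 <= Num.sqrt a.
Proof.
move=> l2; rewrite !ge_max => /and3P[_ _ h].
have h1 : 2 * l + 1 / 4 <= Num.sqrt (4 * l ^+ 2 + 2 * l).
  have <- : Num.sqrt ((2 * l + 1 / 4) ^+ 2) = 2 * l + 1 / 4.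
    by rewrite sqrtr_sqr ger0_norm//; lra.
  by rewrite ler_wsqrtr//; nra.
have <- : Num.sqrt ((24 * l + 3 / 2) ^+ 2) = 24 * l + 3 / 2.
  by rewrite sqrtr_sqr ger0_norm//; lra.
rewrite ler_wsqrtr// (le_trans _ h)//.
set u := Num.sqrt _ in h1 *.
have -> : (24 * l + 3 / 2) ^+ 2 = 36 * (4 * l + 1 / 4) ^+ 2 by field.
by rewrite ler_pM2l// ler_sqr ?nnegrE; lra.
Qed.

(** With sqrt (4 l^2 + 2 l) <= 2 l + 1/2 the largest term is at most 576 l^2 + 144 l + 9, and l >= 2
    turns this into 651 l^2. *)
Lemma stepsize_le l : 2 <= l -> stepsize_of_ln l <= 651 * l ^+ 2.
Proof.
move=> l2; rewrite !ge_max; apply/and3P; split; first by nra.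
  apply: (@le_trans _ _ (16 * l)); last by nra.
  rewrite ler_pdivrMr ?sqrtr_gt0// ler_peMr//; first by lra.
  by have := @ler_wsqrtr R 1 5; rewrite sqrtr1; apply; lra.
have h1 : Num.sqrt (4 * l ^+ 2 + 2 * l) <= 2 * l + 1 / 2.
  have <- : Num.sqrt ((2 * l + 1 / 2) ^+ 2) = 2 * l + 1 / 2.
    by rewrite sqrtr_sqr ger0_norm//; lra.
  by rewrite ler_wsqrtr//; nra.
have h0 := sqrtr_ge0 (4 * l ^+ 2 + 2 * l).
set u := Num.sqrt _ in h0 h1 *.
have -> : 651 * l ^+ 2 = 36 * (651 / 36 * l ^+ 2) by field.
rewrite ler_pM2l//; nra.
Qed.

Lemma stepsize_ge l : 0 <= l -> 144 * l ^+ 2 <= stepsize_of_ln l.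
Proof.
move=> l0; rewrite !le_max; apply/orP; right; apply/orP; right.
have h0 := sqrtr_ge0 (4 * l ^+ 2 + 2 * l).
set u := Num.sqrt _ in h0 *; nra.
Qed.

End parameter_choice.

(** The free level c lets one statement serve both the explicit rate and the target accuracy eps. *)
Lemma clipped_sstm_high_probability (R : realType) (n : nat)
    (dX : measure_display) (Xi : measurableType dX) (D : probability Xi R)
    (f : 'rV[R]_n -> R) (G : 'rV[R]_n -> Xi -> 'rV[R]_n) (L sigma : R)
    (x0 xs : 'rV[R]_n) :
  let C : R := Num.sqrt 5 in
  smooth_convex_problem D f G L sigma xs ->
  let R0 := l2norm (x0 - xs) in
  0 < R0 ->
  forall (beta : R) (N : nat) (a : R),
    0 < beta < 1 -> (1 <= N)%N -> 2 <= ln (4 * N%:R / beta) ->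
    sstm_stepsize C beta N <= a ->
    let m := sstm_batchsize C R0 sigma L a beta N in
    let B := sstm_clipping C R0 beta N in
    forall (c : R), 2 * a * L * C ^+ 2 * R0 ^+ 2 / (N%:R * (N%:R + 3)) <= c ->
    forall (d : measure_display) (T : measurableType d) (P : probability T R)
        (xi : nat -> nat -> {RV P >-> Xi}),
      let yN w := clipped_sstm_output G L a B m x0 (fun k i => xi k i w) N in
      iid_samples D N m xi ->
      ((1 - beta)%:E <=
         P [set w | (f (yN w) - f xs <= c)%R])%E.
Proof.
move=> C pb R0 R00 beta N a /andP[b0 b1] N1 l2 ha m B c hc d T P xi yN iid.
have L0 := L_gt0 pb.
have C2 : C ^+ 2 = 5 by rewrite sqr_sqrtr.
set l := ln (4 * N%:R / beta) in l2.
have sqa : 24 * l + 3 / 2 <= Num.sqrt a by apply: le_sqrt_stepsize.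
have N0 : 0 < N%:R :> R by rewrite ltr0n.
have m0 k : (0 < m k)%N.
  rewrite -(ltr_nat R); apply: (lt_le_trans ltr01).
  by apply: le_trans (ceiln_ge _); rewrite le_max lexx.
have m_large k : 1200 * sigma ^+ 2 * sstm_alpha a L k.+1 ^+ 2 * N%:R * l
    <= R0 ^+ 2 * (m k)%:R.
  rewrite (mulrC (R0 ^+ 2)) -ler_pdivrMr ?exprn_gt0//.
  apply: le_trans (ceiln_ge _); rewrite !le_max; apply/orP; right.
  (* 6000 / C^2 = 1200. *)
  apply/orP; left; rewrite C2 /ln4Nbeta -/l.
  rewrite le_eqVlt; apply/orP; left; apply/eqP.
  by move: (sstm_alpha _ _ _) => al; field; rewrite gt_eqF.
have a0 := sstm_a_gt0 l2 sqa.
have A0 : 0 < sstm_A a L N.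
  by rewrite (sstm_AE L0 l2 sqa) divr_gt0// mulr_gt0// ?addr_gt0// mulr_gt0.
have Ac : 5 * R0 ^+ 2 / 2 <= sstm_A a L N * c.
  rewrite (mulrC (sstm_A a L N)) -(ler_pdivrMr _ _ A0); apply: le_trans hc.
  rewrite (sstm_AE L0 l2 sqa) C2 le_eqVlt; apply/orP; left; apply/eqP; field.
  by rewrite ?(gt_eqF a0, gt_eqF L0, gt_eqF N0)/= gt_eqF// addr_gt0.
apply: le_trans (clipped_sstm_tail pb R00 l2 sqa m0 m_large iid N1 Ac).
rewrite lee_fin lerD2l lerN2.
rewrite expRN lnK ?posrE ?divr_gt0 ?mulr_gt0// invf_div.
rewrite ler_pdivrMr ?mulr_gt0// ler_peMr ?ltW//.
have : 1 <= N%:R :> R by rewrite ler1n.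
lra.
Qed.

(** * Comparison of the logarithms ln (4 N / beta) and ln (X / beta) *)

Section complexity.
Context {R : realType}.
Implicit Types (x X beta l : R) (N : nat).

Lemma ln2_ge_half : 1 / 2 <= ln 2 :> R.
Proof.
have -> : ln 2 = - ln (1 / 2) :> R by rewrite div1r lnV ?posrE// opprK.
have h : -1 < - (1 / 2) :> R by lra.
have := le_ln1Dx h; have -> : 1 - 1 / 2 = 1 / 2 :> R by field.
lra.
Qed.

Lemma ln2_le1 : ln 2 <= 1 :> R.
Proof. by have := @le_ln1Dx R 1; have -> : 1 + 1 = 2 :> R by []; apply; lra. Qed.

Lemma expR2_le16 : expR 2 <= 16 :> R.
Proof.
have h : expR (1 / 2) <= 2 :> R.
  have -> : expR (1 / 2 : R) = (expR (- (1 / 2)))^-1 by rewrite expRN invrK.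
  rewrite invf_ple ?posrE ?expR_gt0//.
  by have := expR_ge1Dx (- (1 / 2) : R); lra.
have -> : expR 2 = expR (1 / 2) ^+ 4 :> R.
  by rewrite -expRM_natl; congr expR; field.
have -> : 16 = 2 ^+ 4 :> R by ring.
by rewrite ler_pXn2r ?nnegrE ?expR_ge0.
Qed.

(* K is a power of 2 with 6510 (2 ln (8 K) + 2)^2 <= K^2; with the bound
   a <= 651 l^2 on the stepsize parameter this gives accuracy eps. *)
Let K : R := 2 ^+ 12.

Let K32 : 32 <= K.
Proof.
have -> : 32 = 2 ^+ 5 :> R by ring.
by apply: ler_weXn2l => //; rewrite ler1n.
Qed.

Variables (X beta : R) (N : nat).
Hypotheses (X2 : 2 <= X) (b0 : 0 < beta) (b1 : beta < 1).
Let La := ln (X / beta).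
Let t := K * Num.sqrt X * La.
Hypotheses (tN : t <= N%:R) (Nt : N%:R <= t + 1).
Let l := ln (4 * N%:R / beta).

Let X0 : 0 < X. Proof. by apply: lt_le_trans X2. Qed.

Let s1 : 1 <= Num.sqrt X.
Proof. by have := @ler_wsqrtr R 1 X; rewrite sqrtr1; apply; have := X2; lra. Qed.

Let sX : Num.sqrt X ^+ 2 = X.
Proof. by rewrite sqr_sqrtr// ltW. Qed.

Let XXb : X <= X / beta.
Proof. by rewrite ler_pdivlMr// ler_piMr// ltW. Qed.

Lemma log_ratio_ge_half : 1 / 2 <= La.
Proof.
apply: (le_trans ln2_ge_half); rewrite ler_ln ?posrE ?divr_gt0//.
exact: le_trans X2 XXb.
Qed.

Let t16 : 16 <= t.
Proof.
have h : 1 * (1 / 2) <= Num.sqrt X * La.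
  by apply: ler_pM => //; exact: log_ratio_ge_half.
have h0 : 0 <= 1 * (1 / 2) :> R by lra.
have := ler_pM (ler0n _ 32) h0 K32 h; rewrite (mulrA K) -/t; lra.
Qed.

Lemma iterations_gt0 : (0 < N)%N.
Proof.
by rewrite -(ltr_nat R); apply: (lt_le_trans _ (le_trans t16 tN)).
Qed.

Let N0 : 0 < N%:R :> R. Proof. by rewrite ltr0n iterations_gt0. Qed.

Let arg0 : 0 < 4 * N%:R / beta.
Proof. by rewrite divr_gt0// mulr_gt0. Qed.

Lemma iterations_le : N%:R <= 2 * t.
Proof. by have := t16; have := Nt; lra. Qed.

Lemma log_iterations_ge2 : 2 <= l.
Proof.
rewrite -[leLHS]expRK ler_ln ?posrE ?expR_gt0//.
apply: (le_trans expR2_le16); rewrite ler_pdivlMr//.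
have := t16; have := tN; have := b1; lra.
Qed.

(** Because sqrt X <= N and beta < 1, X / beta <= (4 N / beta)^2. *)
Lemma log_ratio_le : La <= 2 * l.
Proof.
have -> : 2 * l = ln ((4 * N%:R / beta) ^+ 2) by rewrite lnXn// mulr_natl.
rewrite ler_ln ?posrE; last 2 first.
- exact: divr_gt0.
- exact: exprn_gt0.
have h : Num.sqrt X <= 4 * N%:R.
  apply: (@le_trans _ _ N%:R); last by have := ltW N0; lra.
  apply: le_trans tN; rewrite /t.
  have h1 : Num.sqrt X * (1 / 2) <= Num.sqrt X * La.
    by apply: ler_wpM2l; rewrite ?sqrtr_ge0//; exact: log_ratio_ge_half.
  have h2 : 0 <= Num.sqrt X * La by have := sqrtr_ge0 X; lra.
  have := ler_wpM2r h2 K32; rewrite (mulrA K); have := sqrtr_ge0 X; lra.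
have : X <= (4 * N%:R) ^+ 2 by rewrite -sX ler_sqr ?nnegrE ?sqrtr_ge0// mulr_ge0.
rewrite expr_div_n => h2.
apply: ler_pM => //; [exact: ltW|by rewrite invr_ge0 ltW|].
by rewrite lef_pV2 ?posrE ?exprn_gt0// expr2 ler_piMr// ltW.
Qed.

(** N itself contains the logarithm La, so l contains ln La, absorbed by ln La <= La. From 4 N /
    beta <= 2^15 La (X / beta), l <= 15 ln 2 + 2 La, and 1 <= 2 La gives 30 + 2 = 32. *)
Lemma log_iterations_le : l <= 32 * La.
Proof.
have La0 : 0 < La by apply: lt_le_trans log_ratio_ge_half; lra.
have h : 4 * N%:R / beta <= 2 ^+ 15 * (La * (X / beta)).
  have -> : 2 ^+ 15 * (La * (X / beta)) = (8 * (K * (La * X))) / beta.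
    by rewrite (exprD _ 3 12) -/K; ring.
  rewrite ler_pM2r ?invr_gt0//.
  have : Num.sqrt X <= X by rewrite -{2}sX expr2 ler_peMr ?sqrtr_ge0.
  have KLa : 0 <= K * La by apply: mulr_ge0; [exact: le_trans K32|exact: ltW].
  move=> /(ler_wpM2l KLa); have := iterations_le; rewrite /t; lra.
have Xb0 : 0 < X / beta by rewrite divr_gt0.
have : l <= ln (2 ^+ 15 * (La * (X / beta))).
  rewrite ler_ln ?posrE//; apply: mulr_gt0; first exact: exprn_gt0.
  exact: mulr_gt0.
have -> : ln (2 ^+ 15 * (La * (X / beta))) = 15 * ln 2 + (ln La + La).
  have p2 : 0 < 2 ^+ 15 :> R by exact: exprn_gt0.
  have pL : 0 < La * (X / beta) by exact: mulr_gt0.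
  by rewrite (lnM p2 pL) (lnM La0 Xb0) lnXn// mulr_natl.
have := ln_sublinear La0; have := log_ratio_ge_half; have := ln2_le1; lra.
Qed.

End complexity.

(** * Target accuracy and number of oracle calls *)

Section oracle_complexity.
Context {R : realType}.
Variables (L sigma R0 eps beta : R).
Hypotheses (L0 : 0 < L) (R00 : 0 < R0) (b0 : 0 < beta) (b1 : beta < 1).
Hypotheses (eps0 : 0 < eps) (eps_le : eps <= L * R0 ^+ 2 / 2).
Let X := L * R0 ^+ 2 / eps.
Let La := ln (L * R0 ^+ 2 / (eps * beta)).
Let K : R := 2 ^+ 12.
Let N := ceiln (K * Num.sqrt X * La).
Let l := ln (4 * N%:R / beta).
Let a := stepsize_of_ln l.

Let LaE : La = ln (X / beta).
Proof. by rewrite /La /X invfM mulrA. Qed.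

Let X2 : 2 <= X.
Proof. by rewrite ler_pdivlMr//; have := eps_le; lra. Qed.

Let La_half : 1 / 2 <= La.
Proof. by rewrite LaE; exact: log_ratio_ge_half. Qed.

Let La0 : 0 < La.
Proof. by apply: lt_le_trans La_half; lra. Qed.

Let t := K * Num.sqrt X * ln (X / beta).

Let K0 : 0 < K. Proof. by rewrite exprn_gt0. Qed.

Let tN : t <= N%:R.
Proof. by rewrite /t -LaE; exact: ceiln_ge. Qed.

Let Nt : N%:R <= t + 1.
Proof. by rewrite /t -LaE; apply: ceiln_le; rewrite !mulr_ge0 ?sqrtr_ge0// ltW. Qed.

Lemma iterations_ge1 : (1 <= N)%N.
Proof. exact: (iterations_gt0 X2 b0 b1 tN). Qed.

Lemma log_iterations_lower : 2 <= l.
Proof. exact: (log_iterations_ge2 X2 b0 b1 tN). Qed.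

Let l2 := log_iterations_lower.

Let l0 : 0 < l. Proof. by apply: lt_le_trans l2. Qed.

Let N0 : 0 < N%:R :> R. Proof. by rewrite ltr0n iterations_ge1. Qed.

Let X0 : 0 < X. Proof. by apply: lt_le_trans X2. Qed.

Let sqr_t : t ^+ 2 = K ^+ 2 * (X * La ^+ 2).
Proof.
have -> : t ^+ 2 = K ^+ 2 * (Num.sqrt X ^+ 2 * La ^+ 2) by rewrite /t -LaE; ring.
by rewrite sqr_sqrtr// ltW.
Qed.

Let t0 : 0 <= t.
Proof. by rewrite /t -LaE !mulr_ge0 ?sqrtr_ge0// ltW. Qed.

(** With W = X (32 La)^2, the numerator divided by eps is 10 a X <= 6510 W, while N^2 >= t^2 = 128^2
    W = 16384 W, as K = 128 * 32. *)
Lemma accuracy_reached (C : R) : C ^+ 2 = 5 ->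
  2 * a * L * C ^+ 2 * R0 ^+ 2 / (N%:R * (N%:R + 3)) <= eps.
Proof.
move=> ->; rewrite ler_pdivrMr; last by rewrite mulr_gt0// addr_gt0.
have XE : L * R0 ^+ 2 = X * eps by rewrite /X divfK// gt_eqF.
have -> : 2 * a * L * 5 * R0 ^+ 2 = 10 * a * (L * R0 ^+ 2) by ring.
rewrite XE mulrA (mulrC eps) ler_pM2r//.
set W := X * (32 * La) ^+ 2.
have W0 : 0 <= W by rewrite mulr_ge0 ?sqr_ge0// ltW.
have aW : a * X <= 651 * W.
  have ll : l <= 32 * La by rewrite LaE; exact: (log_iterations_le X2 b0 b1 tN Nt).
  have l32 : l ^+ 2 <= (32 * La) ^+ 2.
    by rewrite ler_sqr// nnegrE; [exact: ltW|rewrite mulr_ge0// ltW].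
  have := ler_wpM2r (ltW X0) (stepsize_le l2); rewrite -/a => /le_trans; apply.
  by have := ler_wpM2r (ltW X0) l32; rewrite /W; lra.
have tW : t ^+ 2 = 128 * (128 * W).
  have KE : K = 128 * 32 by rewrite /K (exprD _ 7 5); ring.
  by rewrite sqr_t KE /W; ring.
have h2 : t ^+ 2 <= N%:R ^+ 2 by rewrite ler_sqr ?nnegrE// ltW.
have -> : N%:R * (N%:R + 3) = N%:R ^+ 2 + 3 * N%:R :> R by ring.
rewrite tW in h2; have := ltW N0; lra.
Qed.

Let a0 : 0 < a.
Proof.
apply: lt_le_trans (stepsize_ge (ltW l0)).
by rewrite mulr_gt0// exprn_gt0.
Qed.

(** Here alpha_(k+1) <= N / (a L) since k + 2 <= 2 N. As l >= 2 and 10368 / 5 <= 2 * 1200, the first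
    variance term dominates the second; the 2 pays for the minimum 1 and the rounding. *)
Lemma batchsize_le (C : R) (k : nat) : C ^+ 2 = 5 -> (k < N)%N ->
  (sstm_batchsize C R0 sigma L a beta N k)%:R <=
  2 + 1200 * sigma ^+ 2 * (N%:R / (a * L)) ^+ 2 * N%:R * l / R0 ^+ 2.
Proof.
move=> C2 kN; rewrite /sstm_batchsize /ln4Nbeta -/l C2.
set al := sstm_alpha a L k.+1.
have al_ge0 : 0 <= al by rewrite /al /= divr_ge0// !mulr_ge0// ltW.
have alN : al <= N%:R / (a * L).
  have -> : N%:R / (a * L) = (2 * N%:R) / (2 * a * L).
    by field; rewrite (gt_eqF a0) (gt_eqF L0).
  rewrite /al /= ler_pM2r ?invr_gt0 ?mulr_gt0//.
  have : k.+1%:R <= N%:R :> R by rewrite ler_nat.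
  have : 1 <= N%:R :> R by rewrite ler1n iterations_ge1.
  by rewrite -[k.+2]addn1 natrD; lra.
have R2 : 0 < R0 ^+ 2 by rewrite exprn_gt0.
pose w := sigma ^+ 2 * N%:R / R0 ^+ 2.
have w0 : 0 <= w.
  by apply: divr_ge0; [apply: mulr_ge0; [exact: sqr_ge0|exact: ltW]|exact: ltW].
have wl0 : 0 <= w * l by apply: mulr_ge0 => //; exact: ltW.
set b := N%:R / (a * L) in alN *.
have -> : 1200 * sigma ^+ 2 * b ^+ 2 * N%:R * l / R0 ^+ 2 = 1200 * (w * l * b ^+ 2).
  by rewrite /w; ring.
have -> : 6000 * sigma ^+ 2 * al ^+ 2 * N%:R * l / (5 * R0 ^+ 2) =
    1200 * (w * l * al ^+ 2) by rewrite /w; field; rewrite gt_eqF.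
have -> : 10368 * sigma ^+ 2 * al ^+ 2 * N%:R / (5 * R0 ^+ 2) =
    10368 / 5 * (w * al ^+ 2) by rewrite /w; field; rewrite gt_eqF.
have h1 : w * l * al ^+ 2 <= w * l * b ^+ 2.
  by apply: ler_wpM2l => //; rewrite ler_sqr// nnegrE (le_trans al_ge0).
have h2 : w * al ^+ 2 * 2 <= w * l * al ^+ 2.
  by rewrite mulrAC; apply: ler_wpM2r; [exact: sqr_ge0|exact: ler_wpM2l].
have h3 : 0 <= w * al ^+ 2 by apply: mulr_ge0 => //; exact: sqr_ge0.
move: h1 h2 h3; move: (w * l * al ^+ 2) (w * l * b ^+ 2) (w * al ^+ 2).
move=> p q r h1 h2 h3; set M := Num.max 1 _.
have M1 : 1 <= M by rewrite le_max lexx.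
apply: le_trans (ceiln_le (le_trans ler01 M1)) _.
suff : M <= 1 + 1200 * q by lra.
rewrite !ge_max; apply/and3P; split; lra.
Qed.

(** The variance part scales as N^4 l / a^2. Four logarithms come from N^4, and a >= 144 l^2 with La
    <= 2 l bounds l / a^2 by a multiple of La^-3, so a single logarithm survives. *)
Lemma oracle_calls_le (C : R) : C ^+ 2 = 5 ->
  (\sum_(k < N) sstm_batchsize C R0 sigma L a beta N k)%:R <=
  (4 * K + 128 * K ^+ 4) *
    (Num.max (Num.sqrt X) (sigma ^+ 2 * R0 ^+ 2 / eps ^+ 2) * La).
Proof.
move=> C2; rewrite natr_sum.
set S := 1200 * sigma ^+ 2 * (N%:R / (a * L)) ^+ 2 * N%:R * l / R0 ^+ 2.
apply: (@le_trans _ _ (\sum_(k < N) (2 + S))).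
  by apply: ler_sum => k _; exact: batchsize_le.
rewrite sumr_const card_ord -[leLHS]mulr_natl mulrDr.
set U := Num.sqrt X; set V := sigma ^+ 2 * R0 ^+ 2 / eps ^+ 2.
have N2t : N%:R <= 2 * t by exact: (iterations_le X2 b0 b1 Nt).
have V0 : 0 <= V.
  by apply: divr_ge0; [apply: mulr_ge0; exact: sqr_ge0|exact: sqr_ge0].
have UM : U * La <= Num.max U V * La by rewrite ler_pM2r// le_max lexx.
have VM : V * La <= Num.max U V * La by rewrite ler_pM2r// le_max lexx orbT.
have h1 : N%:R * 2 <= 4 * K * (U * La).
  by move: N2t; rewrite /t -LaE -/U; lra.
have h2 : N%:R * S <= 128 * K ^+ 4 * (V * La).
  have N4 : N%:R ^+ 4 <= 16 * (K ^+ 2 * (X * La ^+ 2)) ^+ 2.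
    rewrite -sqr_t -exprM; have -> : 16 * t ^+ (2 * 2) = (2 * t) ^+ 4 by ring.
    by apply: lerXn2r; rewrite ?nnegrE//; apply: mulr_ge0.
  have all : 1200 * l / a ^+ 2 <= 8 / La ^+ 3.
    have h : La <= 2 * l by rewrite LaE; exact: (log_ratio_le X2 b0 b1 tN).
    have ha : (144 * l ^+ 2) ^+ 2 <= a ^+ 2.
      apply: lerXn2r; rewrite ?nnegrE; last exact: stepsize_ge (ltW l0).
        by apply: mulr_ge0; [exact: ler0n|exact: sqr_ge0].
      exact: ltW.
    have hl : La ^+ 3 <= (2 * l) ^+ 3.
      apply: lerXn2r => //; rewrite nnegrE; first exact: ltW.
      by apply: mulr_ge0 => //; exact: ltW.
    have h3 : 0 < La ^+ 3 by rewrite exprn_gt0.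
    have a2 : 0 < a ^+ 2 by exact: exprn_gt0.
    have -> : 8 / La ^+ 3 = 8 * a ^+ 2 / La ^+ 3 / a ^+ 2 by field; rewrite !gt_eqF.
    rewrite ler_pM2r ?invr_gt0// ler_pdivlMr//.
    have := ler_wpM2l (ltW l0) hl; have : 0 <= l ^+ 4 by exact/exprn_ge0/ltW.
    lra.
  have -> : N%:R * S = N%:R ^+ 4 * (1200 * l / a ^+ 2) * (sigma ^+ 2 / (L * R0) ^+ 2).
    by rewrite /S; field; rewrite !gt_eqF.
  have -> : 128 * K ^+ 4 * (V * La) =
      16 * (K ^+ 2 * (X * La ^+ 2)) ^+ 2 * (8 / La ^+ 3) * (sigma ^+ 2 / (L * R0) ^+ 2).
    by rewrite /V /X; field; rewrite !gt_eqF.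
  apply: ler_wpM2r; first by apply: divr_ge0; exact: sqr_ge0.
  apply: ler_pM; [exact/exprn_ge0/ltW| |exact: N4|exact: all].
  by apply: divr_ge0; [apply: mulr_ge0; [exact: ler0n|exact: ltW]|exact: sqr_ge0].
have k4 : 0 <= 128 * K ^+ 4.
  by apply: mulr_ge0; [exact: ler0n|exact/exprn_ge0/ltW].
have k1 : 0 <= 4 * K by apply: mulr_ge0; [exact: ler0n|exact: ltW].
have h3 := ler_wpM2l k4 VM; have h4 := ler_wpM2l k1 UM.
by rewrite mulrDl; apply: lerD; [exact: le_trans h4|exact: le_trans h3].
Qed.

End oracle_complexity.

Theorem theoremF1 (R : realType) :
  let C : R := Num.sqrt 5 in
  (forall (n : nat) (dX : measure_display) (Xi : measurableType dX)
      (D : probability Xi R) (f : 'rV[R]_n -> R)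
      (G : 'rV[R]_n -> Xi -> 'rV[R]_n) (L sigma : R) (x0 xs : 'rV[R]_n),
    smooth_convex_problem D f G L sigma xs ->
    let R0 := l2norm (x0 - xs) in
    0 < R0 ->
    forall (beta : R) (N : nat) (a : R),
      0 < beta < 1 -> (1 <= N)%N -> 2 <= ln (4 * N%:R / beta) ->
      sstm_stepsize C beta N <= a ->
      let m := sstm_batchsize C R0 sigma L a beta N in
      let B := sstm_clipping C R0 beta N in
      forall (d : measure_display) (T : measurableType d) (P : probability T R)
          (xi : nat -> nat -> {RV P >-> Xi}),
        iid_samples D N m xi ->
        let yN w := clipped_sstm_output G L a B m x0 (fun k i => xi k i w) N in
        ((1 - beta)%:E <=
           P [set w | (f (yN w) - f xs <=
                       2 * a * L * C ^+ 2 * R0 ^+ 2 / (N%:R * (N%:R + 3)))%R])%E)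
  /\
  (exists K K' : R, [/\ 0 < K, 0 < K' &
    forall (n : nat) (dX : measure_display) (Xi : measurableType dX)
      (D : probability Xi R) (f : 'rV[R]_n -> R)
      (G : 'rV[R]_n -> Xi -> 'rV[R]_n) (L sigma : R) (x0 xs : 'rV[R]_n),
    smooth_convex_problem D f G L sigma xs ->
    let R0 := l2norm (x0 - xs) in
    0 < R0 ->
    forall (beta eps : R),
      0 < beta < 1 -> 0 < eps <= L * R0 ^+ 2 / 2 ->
      let N := ceiln (K * Num.sqrt (L * R0 ^+ 2 / eps)
                        * ln (L * R0 ^+ 2 / (eps * beta))) in
      let a := sstm_stepsize C beta N in
      let m := sstm_batchsize C R0 sigma L a beta N in
      let B := sstm_clipping C R0 beta N in
      (forall (d : measure_display) (T : measurableType d) (P : probability T R)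
          (xi : nat -> nat -> {RV P >-> Xi}),
        iid_samples D N m xi ->
        let yN w := clipped_sstm_output G L a B m x0 (fun k i => xi k i w) N in
        ((1 - beta)%:E <= P [set w | (f (yN w) - f xs <= eps)%R])%E)
      /\
      (\sum_(k < N) m k)%:R <=
        K' * (Num.max (Num.sqrt (L * R0 ^+ 2 / eps))
                      (sigma ^+ 2 * R0 ^+ 2 / eps ^+ 2)
              * ln (L * R0 ^+ 2 / (eps * beta)))]).
Proof.
move=> C; have C2 : C ^+ 2 = 5 by rewrite sqr_sqrtr.
split.
  move=> n dX Xi D f G L sigma x0 xs pb R0 R00 beta N a b01 N1 l2 ha m B d T P xi iid.
  exact: (clipped_sstm_high_probability pb R00 b01 N1 l2 ha (lexx _) iid).
exists (2 ^+ 12), (4 * 2 ^+ 12 + 128 * (2 ^+ 12) ^+ 4); split.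
- exact: exprn_gt0.
- by rewrite addr_gt0// mulr_gt0// exprn_gt0// exprn_gt0.
move=> n dX Xi D f G L sigma x0 xs pb R0 R00 beta eps b01 /andP[eps0 eps_le] N a m B.
have L0 := L_gt0 pb; have /andP[b0 b1] := b01.
split; last exact: oracle_calls_le.
move=> d T P xi iid.
apply: (clipped_sstm_high_probability pb R00 b01 _ _ (lexx _) _ iid).
- exact: iterations_ge1.
- exact: log_iterations_lower.
- exact: accuracy_reached.
Qed.
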